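(* Let $f$ be a Bernstein function satisfying Hypothesis (H) (stated in the context) with parameter $\alpha\in(0,1)$, let $X_t$ be the subordinator with Laplace exponent $f$, and let $B_{X_t}$ be the corresponding subordinate Brownian motion on $\mathbb{R}^n$. Then, for every $\beta>0$ with $\beta\neq 2\alpha$, with probability one, \[ \lim_{t\to 0^+} t^{-1/\beta}\,\sup_{s\le t}\left|B_{X_s}\right| = \begin{cases} 0 & \text{if } \beta>2\alpha,\\ \infty & \text{if } \beta<2\alpha.\end{cases} \]
   Context: Hypothesis (H): $f(\lambda)=\int_0^\infty(1-e^{-\lambda t})\,m(t)\,dt$ is a Bernstein function (on $(0,\infty)$, extended continuously to $[0,\infty)$) whose Lévy measure $m(t)\,dt$ on $(0,\infty)$ satisfies $m\ge 0$ a.e. and $\int_0^\infty \min(t,1)\,m(t)\,dt<\infty$, with locally integrable density $m:(0,\infty)\to\mathbb{R}$ such that (i) there are $\alpha\in(0,1)$ and real numbers $p_0,p_1,\dots$ with $m(t)\sim t^{-1-\alpha}\sum_{k=0}^\infty p_k t^k$ as $t\to0^+$, i.e. for every $N\ge 0$, $t^{1+\alpha-N}\big(m(t)-\sum_{k=0}^N p_k t^{k-1-\alpha}\big)\to 0$ as $t\to0^+$; (ii) for every $\beta\in\mathbb{R}$ the function $m(t)t^\beta$ is bounded a.e. on $t>1$; (iii) $\overline m(0,\infty):=\int_0^\infty\big(m(t)-p_0t^{-1-\alpha}\big)\,dt<0$. The subordinator $X_t$ is an increasing Lévy process with values in $[0,\infty)$, $X_0=0$ a.s. and $\mathbb{E}(e^{-\lambda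 X_t})=e^{-tf(\lambda)}$ for $\lambda>0$. $B_t$ is a Brownian motion on $\mathbb{R}^n$ independent of $X_t$, started at $0$ and normalized by $\mathbb{E}(e^{i\xi\cdot B_t})=e^{-t|\xi|^2}$; hence $\mathbb{E}(e^{i\xi\cdot B_{X_t}})=e^{-tf(|\xi|^2)}$. *)

(* Defs.v *)
From HB Require Import structures.
From mathcomp Require Import all_boot all_order all_algebra finmap.
From mathcomp Require Import complex.
From mathcomp Require Import all_classical all_reals all_analysis.

Set Implicit Arguments.
Unset Strict Implicit.
Unset Printing Implicit Defensive.

Import Order.TTheory GRing.Theory Num.Theory.
Import numFieldNormedType.Exports.

Local Open Scope classical_set_scope.
Local Open Scope ring_scope.

(* Only the values of [f] on [0, +oo[ matter. *)
Definition is_bernstein (R : realType) (f : R -> R) : Prop :=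
  [/\ forall (k : nat) (x : R), 0 < x -> derivable (derive1n k f) x 1,
      forall x : R, 0 < x -> 0 <= f x,
      forall (k : nat) (x : R), 0 < x -> 0 <= (-1) ^+ k * derive1n k.+1 f x &
      f x @[x --> (0 : R)^'+] --> f 0].

(* [f] has Levy measure [m(t) dt], and neither killing nor drift. *)
Definition has_levy_density (R : realType) (f m : R -> R) : Prop :=
  [/\ locally_integrable `](0%R : R), +oo[ m,
      {ae (@lebesgue_measure R), forall t : R, 0 < t -> 0 <= m t},
      (\int[@lebesgue_measure R]_(t in `](0%R : R), +oo[)
         (Num.min t 1 * m t)%:E < +oo)%E &
      forall lambda : R, 0 <= lambda ->
        (\int[@lebesgue_measure R]_(t in `](0%R : R), +oo[)
           ((1 - expR (- (lambda * t))) * m t)%:E = (f lambda)%:E)%E].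

Record hypothesis_H (R : realType) (f m : R -> R) (alpha : R) (p : nat -> R) :
    Prop := HypothesisH {
  H_bernstein : is_bernstein f ;
  H_density : has_levy_density f m ;
  H_alpha : 0 < alpha < 1 ;
  H_asymptotics : forall N : nat,
    t `^ (1 + alpha - N%:R) *
      (m t - \sum_(k < N.+1) p k * t `^ (k%:R - 1 - alpha))
      @[t --> (0 : R)^'+] --> (0 : R) ;
  H_decay : forall beta : R, exists C : R,
    {ae (@lebesgue_measure R), forall t : R, 1 < t -> `|m t * t `^ beta| <= C} ;
  H_negative_mass :
    (\int[@lebesgue_measure R]_(t in `](0%R : R), +oo[)
       (m t - p 0%N * t `^ (- 1 - alpha))%:E < 0)%E
}.

Definition borel_sets (U : topologicalType) : set (set U) := <<s @open U >>.

(* The sigma-algebra {Z^-1(A) | A Borel}; this avoids fixing a measurable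
   structure on the codomain, so that it also applies to row vectors. *)
Definition sigma_rv (T : Type) (U : topologicalType) (Z : T -> U) :
    set (set T) :=
  preimage_set_system setT Z (@borel_sets U).

Definition sigma_process (R : realType) (T : Type) (U : topologicalType)
    (Z : R -> T -> U) : set (set T) :=
  <<s \bigcup_(t in [set t : R | 0 <= t]) sigma_rv (Z t) >>.

Definition mutually_independent (d : measure_display) (T : measurableType d)
    (R : realType) (P : probability T R) (I : choiceType)
    (F : I -> set (set T)) : Prop :=
  forall (J : {fset I}) (A : I -> set T),
    (forall i, i \in J -> F i (A i)) ->
    P (\bigcap_(i in [set` J]) A i) = (\prod_(i <- J) P (A i))%E.

Definition independent_processes (d : measure_display) (T : measurableType d)
    (R : realType) (P : probability T R) (U V : topologicalType)
    (Y : R -> T -> U) (Z : R -> T -> V) : Prop :=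
  forall A C : set T, sigma_process Y A -> sigma_process Z C ->
    P (A `&` C) = (P A * P C)%E.

(* Processes are indexed by the times in [0, +oo[; their values at negative
   times are junk and are never constrained. *)
Record is_levy_process (d : measure_display) (T : measurableType d)
    (R : realType) (P : probability T R) (U : pseudoMetricNormedZmodType R)
    (Z : R -> T -> U) : Prop := IsLevyProcess {
  levy_measurable : forall t, 0 <= t -> sigma_rv (Z t) `<=` measurable ;
  levy_start : {ae P, forall w, Z 0 w = 0} ;
  levy_indep_increments : forall (k : nat) (t : nat -> R),
    0 <= t 0%N -> (forall i, (i < k)%N -> t i <= t i.+1) ->
    mutually_independent P
      (fun i : 'I_k => sigma_rv (fun w => Z (t i.+1) w - Z (t i) w)) ;
  levy_stationary_increments : forall (s t : R) (A : set U),
    0 <= s -> 0 <= t -> borel_sets A ->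
    P [set w | A (Z (s + t) w - Z s w)] = P [set w | A (Z t w)] ;
  levy_stochastic_continuity : forall (t e : R), 0 <= t -> 0 < e ->
    P [set w | e < `|Z s w - Z t w|]
      @[s --> within [set s : R | 0 <= s] (nbhs t)] --> 0%E ;
  levy_cadlag : {ae P, forall w,
    (forall t, 0 <= t -> Z s w @[s --> t^'+] --> Z t w) /\
    (forall t, 0 < t -> cvg (Z s w @[s --> t^'-]))}
}.

Record is_subordinator (d : measure_display) (T : measurableType d)
    (R : realType) (P : probability T R) (f : R -> R) (X : R -> T -> R) :
    Prop := IsSubordinator {
  subordinator_levy : is_levy_process P X ;
  subordinator_ge0 : forall t w, 0 <= t -> 0 <= X t w ;
  subordinator_increasing : {ae P, forall w,
    forall s t, 0 <= s -> s <= t -> X s w <= X t w} ;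
  subordinator_laplace : forall t lambda, 0 <= t -> 0 < lambda ->
    'E_P[fun w => expR (- (lambda * X t w))]%E = (expR (- (t * f lambda)))%:E
}.

Definition dot (R : realType) (n : nat) (x y : 'rV[R]_n) : R :=
  \sum_(i < n) x 0 i * y 0 i.

(* Euclidean norm; the library's norm on row vectors is the maximum norm. *)
Definition enorm (R : realType) (n : nat) (x : 'rV[R]_n) : R :=
  Num.sqrt (dot x x).

(* E(exp(i xi.Y)), whose real and imaginary parts are E(cos(xi.Y)) and
   E(sin(xi.Y)). *)
Definition characteristic_function (d : measure_display)
    (T : measurableType d) (R : realType) (P : probability T R) (n : nat)
    (Y : T -> 'rV[R]_n) (xi : 'rV[R]_n) : R[i] :=
  (\int[P]_w cos (dot xi (Y w)) +i* \int[P]_w sin (dot xi (Y w)))%C.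

(* Brownian motion with covariance 2t.I at time t, started at 0. *)
Record is_brownian_motion (d : measure_display) (T : measurableType d)
    (R : realType) (P : probability T R) (n : nat) (B : R -> T -> 'rV[R]_n) :
    Prop := IsBrownianMotion {
  brownian_levy : is_levy_process P B ;
  brownian_continuous : {ae P, forall w,
    {within `[(0 : R), +oo[, continuous (fun t : R => B t w)}} ;
  brownian_char : forall (t : R) (xi : 'rV[R]_n), 0 <= t ->
    characteristic_function P (B t) xi =
      (expR (- (t * enorm xi ^+ 2)))%:C%C
}.

(* Main.v *)
Require Import Defs.
From HB Require Import structures.
From mathcomp Require Import all_boot all_order all_algebra.
From mathcomp Require Import all_classical all_reals all_analysis.
From mathcomp Require Import measurable_realfun.
From mathcomp Require Import ring lra.

Set Implicit Arguments.
Unset Strict Implicit.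
Unset Printing Implicit Defensive.

Import Order.TTheory GRing.Theory Num.Theory.
Import numFieldNormedType.Exports.

Local Open Scope classical_set_scope.
Local Open Scope ring_scope.

(** Idea.  Since [m(t) ~ p_0 t^(-1-alpha)] at [0] with [p_0 > 0] (this positivity
    is what the negative mass condition provides), [f(l)] is at least of order
    [l^alpha] and at most of order [l^b] for every [b > alpha].  Evaluating the
    Laplace transform of [X_t] at the inverse of the level bounds both tails of
    [X_t], and Borel-Cantelli along the times [e^(-k)] shows that [X_t] eventually
    lies between [t^(1/g)] for [g < alpha] and [t^(1/g)] for [g > alpha].

    For [beta > 2 alpha], chaining over dyadic points, fed with a fourth moment
    tail bound, gives [sup_(u <= r) |B_u| = O(r^k)] for every [k < 1/2], and
    [X] is increasing.  For [beta < 2 alpha] it suffices to look at the single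
    value [B_(X_t)]: conditionally on [X], a coordinate of it is in [[-b, b]] with
    probability [O(b / sqrt X_t)], and Borel-Cantelli applies again.

    Both Gaussian estimates are read off the values [E cos(c Y) = exp(-u c^2)]
    through nonnegative trigonometric polynomials: [(1 - cos)^2] for the tail and
    [|sum_(k < N) e^(ik.)|^2] for the small ball. *)

(** * Borel-Cantelli with geometric bounds *)

(** The finite sum has the closed form [(1 - q ^+ N) / (1 - q)], whose numerator is at most [1]. *)
Lemma sum_geometric_le (R : realType) (q : R) (N : nat) :
  0 < q < 1 -> \sum_(0 <= k < N) q ^+ k <= (1 - q)^-1.
Proof.
move=> /andP[q0 q1]; have q1' : 0 < 1 - q by rewrite subr_gt0.
have -> : \sum_(0 <= k < N) q ^+ k = (1 - q ^+ N) / (1 - q).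
  rewrite -[RHS]mulr1; elim: N => [|N IH]; first by rewrite big_nil expr0; ring.
  by rewrite big_nat_recr//= IH exprS; field; rewrite gt_eqF.
by rewrite ler_pdivrMr// mulVf ?gt_eqF// lerBlDr lerDl exprn_ge0// ltW.
Qed.

Lemma nneseries_geometric_le (R : realType) (A q : R) : 0 <= A -> 0 < q < 1 ->
  (\sum_(k <oo) (A * q ^+ k)%:E <= (A / (1 - q))%:E)%E.
Proof.
move=> A0 /[dup] q01 /andP[q0 q1]; apply: lime_le.
  by apply: is_cvg_nneseries => k _ _; rewrite lee_fin mulr_ge0// exprn_ge0// ltW.
apply: nearW => N; rewrite sumEFin lee_fin -mulr_sumr ler_wpM2l//.
exact: sum_geometric_le.
Qed.

Lemma measure_bigcup_le_geometric (R : realType) (d : measure_display)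
    (T : measurableType d) (P : {measure set T -> \bar R}) (F : nat -> set T)
    (A q : R) :
  (forall k, measurable (F k)) -> 0 <= A -> 0 < q < 1 ->
  (forall k, P (F k) <= (A * q ^+ k)%:E)%E ->
  (P (\bigcup_k F k) <= (A / (1 - q))%:E)%E.
Proof.
move=> mF A0 q01 PF; apply: le_trans (nneseries_geometric_le A0 q01).
apply: (@le_trans _ _ (\sum_(k <oo) P (F k))%E).
  by apply: measure_sigma_subadditive => //; exact: bigcup_measurable.
by apply: lee_nneseries => // k _; exact: PF.
Qed.

Lemma borel_cantelli_geometric (R : realType) (d : measure_display)
    (T : measurableType d) (P : {measure set T -> \bar R}) (F : nat -> set T)
    (A q : R) :
  (forall k, measurable (F k)) -> 0 <= A -> 0 < q < 1 ->
  (forall k, P (F k) <= (A * q ^+ k)%:E)%E ->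
  {ae P, forall w, \forall k \near \oo, ~ F k w}.
Proof.
move=> mF A0 q01 PF.
have F0 : P (lim_sup_set F) = 0%E.
  apply: lim_sup_set_cvg0 => //.
  apply: le_lt_trans (_ : (\sum_(k <oo) (A * q ^+ k)%:E < +oo)%E).
    by apply: lee_nneseries => // k _; exact: PF.
  by apply: le_lt_trans (nneseries_geometric_le A0 q01) _; rewrite ltry.
exists (lim_sup_set F); split => //.
  by apply: bigcapT_measurable => n; exact: bigcup_measurable.
move=> w /= nw n _; apply: contrapT => h; apply: nw.
near=> k => Fk; apply: h; exists k => //=.
by near: k; exact: nbhs_infty_ge.
Unshelve. all: by end_near. Qed.

(** Markov's inequality, in product form so that no extended real is divided. Every tail bound below
    is an instance of it, for a suitable nonnegative [g]. *)
Lemma markov_bound (R : realType) (d : measure_display)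
    (T : measurableType d) (P : {measure set T -> \bar R}) (A : set T)
    (g : T -> R) (c : R) :
  measurable A -> measurable_fun [set: T] g -> (forall w, 0 <= g w) ->
  0 <= c -> (forall w, A w -> c <= g w) ->
  (c%:E * P A <= \int[P]_w (g w)%:E)%E.
Proof.
move=> mA mg g0 c0 cg; rewrite -integral_cst//.
have mg' : measurable_fun [set: T] (fun w => (g w)%:E) by exact/measurable_EFinP.
apply: (@le_trans _ _ (\int[P]_(w in A) (g w)%:E)%E).
  apply: ge0_le_integral => //.
  - exact: measurable_funTS.
by apply: ge0_subset_integral => //; move=> w _; rewrite lee_fin.
Qed.

(** Transfers estimates along the times [expR (- k%:R)] to all small [t]; the index is the integer
    part of [- ln t]. *)
Lemma expR_bracket (R : realType) (t : R) : 0 < t <= 1 ->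
  exists k : nat, expR (- k.+1%:R) < t <= expR (- k%:R).
Proof.
move=> /andP[t0 t1]; exists (Num.truncn (- ln t)).
have l0 : 0 <= - ln t by rewrite oppr_ge0; exact: ln_le0.
have /andP[h1 h2] := truncn_itv l0.
have tE : expR (ln t) = t by rewrite lnK.
apply/andP; split; first by rewrite -[ltRHS]tE ltr_expR; lra.
by rewrite -[leLHS]tE ler_expR; lra.
Qed.

Lemma expR_N_near0 (R : realType) (K : nat) (t : R) (k : nat) :
  t < expR (- K%:R) -> expR (- k.+1%:R) < t -> (K <= k)%N.
Proof.
move=> tK kt; have := lt_trans kt tK.
by rewrite ltr_expR ltrN2 ltr_nat ltnS.
Qed.

(** * Gaussian estimates from the characteristic function *)

Lemma sin_le_id (R : realType) (x : R) : 0 <= x -> sin x <= x.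
Proof.
move=> x0; have [//|c _] := @MVT_segment R sin cos 0 x x0 _ _.
  by apply: continuous_subspaceT => y; exact: continuous_sin.
by rewrite sin0 !subr0 => ->; rewrite -[leRHS]mul1r ler_wpM2r// cos_le1.
Qed.

Lemma cosE_half (R : realType) (x : R) : cos x = 1 - 2 * sin (x / 2) ^+ 2.
Proof.
rewrite {1}(_ : x = (x / 2) *+ 2); last by rewrite -mulr_natr; field.
by rewrite cos_mulr2n cos2sin2; ring.
Qed.

Lemma cos_ge_half (R : realType) (x : R) : `|x| <= 1 -> 1 / 2 <= cos x.
Proof.
move=> x1; rewrite -cos_norm cosE_half.
have s0 : 0 <= sin (`|x| / 2).
  apply: sin_ge0_pi; have := pi_ge2 R; have := normr_ge0 x; lra.
have s1 : sin (`|x| / 2) <= `|x| / 2 by apply: sin_le_id; rewrite divr_ge0.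
nra.
Qed.

Lemma sin_ge_half (R : realType) (x : R) : 0 <= x <= 1 -> x / 2 <= sin x.
Proof.
move=> /andP[x0 x1]; have [//|c /andP[c0 cx]] := @MVT_segment R sin cos 0 x x0 _ _.
  by apply: continuous_subspaceT => y; exact: continuous_sin.
rewrite !bnd_simp in c0 cx; rewrite sin0 !subr0 => ->.
rewrite mulrC ler_wpM2r// -[_^-1]mul1r cos_ge_half// ger0_norm//.
exact: le_trans cx x1.
Qed.

(** By the half-angle formula the right side is [2 * sin (x / 2) ^+ 2], and [sin y >= y / 2] on
    [[0, 1]]. *)
Lemma one_minus_cos_ge (R : realType) (x : R) :
  `|x| <= 1 -> x ^+ 2 / 8 <= 1 - cos x.
Proof.
move=> x1; rewrite -cos_norm -(real_normK (num_real x)) cosE_half.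
have s0 : `|x| / 2 / 2 <= sin (`|x| / 2).
  by apply: sin_ge_half; have := normr_ge0 x; lra.
have := normr_ge0 x; nra.
Qed.

(** * Integrals of bounded functions and of finite sums *)

Section bounded_functions.
Context {R : realType} {d : measure_display} {T : measurableType d}.
Variable P : probability T R.

Lemma bounded_integrable (g : T -> R) (M : R) :
  measurable_fun [set: T] g -> (forall w, `|g w| <= M) ->
  P.-integrable [set: T] (fun w => (g w)%:E).
Proof.
move=> mg gM; apply: measurable_bounded_integrable => //.
  by rewrite -ge0_fin_numE ?fin_num_measure.
exists M; split; first exact: num_real.
by move=> x /ltW Mx w _; exact: le_trans (gM w) Mx.
Qed.

Lemma EFin_Rintegral (g : T -> R) : P.-integrable [set: T] (fun w => (g w)%:E) ->
  (\int[P]_w (g w)%:E)%E = (\int[P]_w g w)%:E.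
Proof. by move=> ig; rewrite /Rintegral fineK//; exact: integrable_fin_num. Qed.

Lemma integrable_sum_nat (g : nat -> T -> R) (N : nat) :
  (forall i, P.-integrable [set: T] (fun w => (g i w)%:E)) ->
  P.-integrable [set: T] (fun w => (\sum_(0 <= i < N) g i w)%:E).
Proof.
move=> ig; elim: N => [|N IH].
  by under eq_fun do rewrite big_nil; exact: integrable0.
under eq_fun do rewrite big_nat_recr//= EFinD.
exact: integrableD.
Qed.

Lemma Rintegral_sum_nat (g : nat -> T -> R) (N : nat) :
  (forall i, P.-integrable [set: T] (fun w => (g i w)%:E)) ->
  \int[P]_w (\sum_(0 <= i < N) g i w) = \sum_(0 <= i < N) \int[P]_w g i w.
Proof.
move=> ig; elim: N => [|N IH].
  under eq_Rintegral do rewrite big_nil.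
  by rewrite big_nil Rintegral_cst// mul0r.
under eq_Rintegral do rewrite big_nat_recr//=.
rewrite big_nat_recr//= RintegralD ?IH//; last exact: ig.
exact: (integrable_sum_nat N ig).
Qed.

End bounded_functions.

(* The squared modulus of [\sum_(k < N) e^(ikx)]. *)
Lemma sqr_sum_cos_sin (R : realType) (N : nat) (x : R) :
  (\sum_(0 <= i < N) cos (i%:R * x)) ^+ 2 + (\sum_(0 <= i < N) sin (i%:R * x)) ^+ 2
  = \sum_(0 <= i < N) \sum_(0 <= j < N) cos ((i%:R - j%:R) * x).
Proof.
rewrite !expr2 !big_distrlr/= -big_split/=; apply: eq_bigr => i _.
by rewrite -big_split/=; apply: eq_bigr => j _; rewrite mulrBl cosB.
Qed.

Lemma expR_sqr_le_half (R : realType) (m : nat) :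
  expR (- (m%:R ^+ 2)) <= (2^-1) ^+ m :> R.
Proof.
have e2 : 2 <= expR 1 :> R by have := @expR_ge1Dx R 1; lra.
rewrite expRN exprVn lef_pV2 ?posrE ?expR_gt0 ?exprn_gt0//.
rewrite (le_trans (_ : _ <= expR 1 ^+ m))//; first by rewrite lerXn2r ?nnegrE ?expR_ge0.
rewrite -expRM_natl mulr1 ler_expR -natrX ler_nat.
by case: m => // m; rewrite -[leqLHS]expn1 leq_pexp2l.
Qed.

(** Induction on the size of the square array: the new row and the new column each add at most [1],
    by comparison with the series of [2^-k], and the new diagonal entry adds exactly [1]. *)
Lemma double_gaussian_sum_le (R : realType) (N : nat) :
  \sum_(0 <= i < N) \sum_(0 <= j < N) expR (- (i%:R - j%:R) ^+ 2) <= 3 * N%:R :> R.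
Proof.
have row n : \sum_(0 <= j < n) expR (- (n%:R - j%:R) ^+ 2) <= 1 :> R.
  apply: (@le_trans _ _ (\sum_(0 <= j < n) (2^-1) ^+ (n - j))).
    apply: ler_sum_nat => j /andP[_ jn].
    by rewrite -natrB ?(ltnW jn)//; exact: expR_sqr_le_half.
  elim: n => [|n IH]; first by rewrite big_nil.
  rewrite big_nat_recr//= subSnn expr1.
  rewrite (eq_big_nat _ _ (F2 := fun j => 2^-1 * 2^-1 ^+ (n - j))); last first.
    by move=> j /andP[_ jn]; rewrite subSn ?(ltnW jn)// exprS.
  by rewrite -mulr_sumr; lra.
elim: N => [|N IH]; first by rewrite big_nil mulr0.
rewrite big_nat_recr//=.
under eq_bigr do rewrite big_nat_recr//=.
rewrite big_split/= big_nat_recr//= subrr expr0n oppr0 expR0.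
under [X in _ + X + _ <= _]eq_bigr do rewrite -sqrrN opprB.
by rewrite -[in leRHS]natr1; have := row N; lra.
Qed.

(** * Small-ball and tail bounds for a centred Gaussian variable of variance [2 * u] *)

Section gaussian_estimates.
Context {R : realType} {d : measure_display} {T : measurableType d}.
Variables (P : probability T R) (Y : T -> R) (u : R).
Hypothesis mY : measurable_fun [set: T] Y.
Hypothesis charY : forall c : R, \int[P]_w cos (c * Y w) = expR (- (u * c ^+ 2)).

Lemma measurable_cosM (c : R) : measurable_fun [set: T] (fun w => cos (c * Y w)).
Proof.
apply: measurableT_comp; last exact: measurable_funM.
by apply: continuous_measurable_fun; exact: continuous_cos.
Qed.

Lemma integrable_cosM (c : R) :
  P.-integrable [set: T] (fun w => (cos (c * Y w))%:E).
Proof.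
apply: (@bounded_integrable _ _ _ _ _ 1); first exact: measurable_cosM.
by move=> w; exact: cos_max.
Qed.

Lemma measurable_norm_le (b : R) : measurable [set w | `|Y w| <= b].
Proof.
rewrite -[X in measurable X]setTI.
have -> : [set w | `|Y w| <= b] = (fun w => `|Y w|) @^-1` `]-oo, b].
  by apply/seteqP; split => w /=; rewrite in_itv.
have : measurable_fun [set: T] (fun w => `|Y w|) by exact: measurableT_comp.
by apply.
Qed.

Lemma measurable_lt_norm (b : R) : measurable [set w | b < `|Y w|].
Proof.
have -> : [set w | b < `|Y w|] = ~` [set w | `|Y w| <= b].
  by apply/seteqP; split => w /=; rewrite ltNge => /negP.
exact/measurableC/measurable_norm_le.
Qed.

(** Markov's inequality for [g], the squared modulus of [M] exponentials: its mean is at most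
    [3 * M], whereas on the ball the cosine sum alone makes it at least [M ^ 2 / 4]. *)
Lemma gaussian_small_ball (N : nat) (b : R) : 0 < u -> b * N.+1%:R <= Num.sqrt u ->
  (P [set w | (`|Y w| <= b)%R] <= (12 / N.+1%:R)%:E)%E.
Proof.
move=> u0 bN; set M := N.+1; have M0 : 0 < M%:R :> R by rewrite ltr0n.
have su : 0 < Num.sqrt u by rewrite sqrtr_gt0.
(* This scaling gives [u * c ^ 2 = 1], so the mean of [g] is the double sum of [exp(-(i - j)^2)]; on
   the ball it keeps every angle [i * c * Y], [i < M], in [[-1, 1]], where the cosine is at least
   [1/2]. *)
pose c := (Num.sqrt u)^-1; have c0 : 0 < c by rewrite invr_gt0.
pose g (w : T) : R := \sum_(0 <= i < M) \sum_(0 <= j < M) cos (((i%:R - j%:R) * c) * Y w).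
have gE w : g w = (\sum_(0 <= i < M) cos (i%:R * (c * Y w))) ^+ 2
               + (\sum_(0 <= i < M) sin (i%:R * (c * Y w))) ^+ 2.
  rewrite sqr_sum_cos_sin; apply: eq_bigr => i _; apply: eq_bigr => j _.
  by rewrite mulrA.
have ig i : P.-integrable [set: T]
    (fun w => (\sum_(0 <= j < M) cos (((i%:R - j%:R) * c) * Y w))%:E).
  by apply: integrable_sum_nat => j; exact: integrable_cosM.
have Ig : P.-integrable [set: T] (fun w => (g w)%:E).
  exact: (@integrable_sum_nat _ _ _ P
    (fun i w => \sum_(0 <= j < M) cos (((i%:R - j%:R) * c) * Y w))).
have intg : \int[P]_w g w <= 3 * M%:R.
  rewrite (@Rintegral_sum_nat _ _ _ P
    (fun i w => \sum_(0 <= j < M) cos (((i%:R - j%:R) * c) * Y w)))//.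
  apply: le_trans (double_gaussian_sum_le _ _); apply: ler_sum => i _.
  rewrite (@Rintegral_sum_nat _ _ _ P
    (fun j w => cos (((i%:R - j%:R) * c) * Y w))); last first.
    by move=> j; exact: integrable_cosM.
  apply: ler_sum => j _; rewrite charY ler_expR lerN2.
  by rewrite exprMn exprVn sqr_sqrtr ?(ltW u0)// mulrCA divff ?mulr1// gt_eqF.
have : ((M%:R ^+ 2 / 4)%:E * P [set w | (`|Y w| <= b)%R] <= (3 * M%:R)%:E)%E.
  apply: (@le_trans _ _ (\int[P]_w (g w)%:E)%E); last first.
    by rewrite EFin_Rintegral// lee_fin.
  apply: markov_bound.
  - exact: measurable_norm_le.
  - exact/measurable_EFinP/measurable_int/Ig.
  - by move=> w; rewrite gE addr_ge0// sqr_ge0.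
  - by rewrite divr_ge0// sqr_ge0.
  move=> w /= Yb; rewrite gE.
  have cge : M%:R / 2 <= \sum_(0 <= i < M) cos (i%:R * (c * Y w)).
    rewrite (_ : M%:R / 2 = \sum_(0 <= i < M) (1 / 2)); last first.
      by rewrite sumr_const_nat subn0 -mulr_natl; field.
    apply: ler_sum_nat => i /andP[_ iM]; apply: cos_ge_half.
    rewrite !normrM normr_nat (gtr0_norm c0).
    apply: (@le_trans _ _ (M%:R * (c * b))).
      by rewrite ler_pM// ?ler_nat ?(ltnW iM) ?mulr_ge0 ?(ltW c0)// ler_pM2l.
    by rewrite mulrCA mulrC ler_pdivrMr// mul1r mulrC.
  rewrite -[leLHS]addr0 lerD ?sqr_ge0//.
  rewrite (_ : M%:R ^+ 2 / 4 = (M%:R / 2) ^+ 2); last by field.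
  by rewrite lerXn2r// ?nnegrE ?divr_ge0// ?(le_trans _ cge) ?divr_ge0.
rewrite -lee_pdivlMl; last by rewrite divr_gt0// exprn_gt0.
move=> /le_trans; apply; rewrite -EFinM lee_fin le_eqVlt; apply/orP; left.
by apply/eqP; field; rewrite gt_eqF.
Qed.

(** The function [(1 - cos (c * Y)) ^ 2] acts as a bounded substitute for the fourth power of
    [c * Y]. The cut-off at [M = 1 / c] keeps [c * Y] in the range where [1 - cos] dominates a
    square, and the final bound does not depend on [M]. *)
Lemma gaussian_tail_trunc (a M : R) : 0 <= u -> 0 < a -> 0 < M ->
  (P [set w | (a < `|Y w|)%R /\ (`|Y w| <= M)%R] <= (192 * u ^+ 2 / a ^+ 4)%:E)%E.
Proof.
move=> u0 a0 M0; pose c := M^-1; have c0 : 0 < c by rewrite invr_gt0.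
pose g (w : T) : R := (1 - cos (c * Y w)) ^+ 2.
have gE w : g w = 3 / 2 - 2 * cos (c * Y w) + 2^-1 * cos ((2 * c) * Y w).
  rewrite /g (_ : 2 * c * Y w = (c * Y w) *+ 2) ?cos_mulr2n; last first.
    by rewrite -mulr_natr; ring.
  by rewrite -mulr_natr; field.
have i1 : P.-integrable [set: T] (fun w => (2 * cos (c * Y w))%:E).
  by under eq_fun do rewrite EFinM; apply: integrableZl => //; exact: integrable_cosM.
have i2 : P.-integrable [set: T] (fun w => (2^-1 * cos ((2 * c) * Y w))%:E).
  by under eq_fun do rewrite EFinM; apply: integrableZl => //; exact: integrable_cosM.
have i0 : P.-integrable [set: T] (fun w => (3 / 2 : R)%:E).
  by apply: (@bounded_integrable _ _ _ _ _ `|3 / 2|).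
have i3 : P.-integrable [set: T] (fun w => (3 / 2 - 2 * cos (c * Y w))%:E).
  by under eq_fun do rewrite EFinB; exact: integrableB.
have Ig : P.-integrable [set: T] (fun w => (g w)%:E).
  by under eq_fun do rewrite gE EFinD; exact: integrableD.
have intg : \int[P]_w g w <= 3 * (u * c ^+ 2) ^+ 2.
  under eq_Rintegral do rewrite gE.
  rewrite RintegralD// RintegralB// Rintegral_cst// (_ : fine _ = 1) ?mulr1; last first.
    by have := congr1 fine (@probability_setT _ _ _ P).
  rewrite !RintegralZl ?charY//; do ?exact: integrable_cosM.
  set s := u * c ^+ 2; have s0 : 0 <= s by rewrite mulr_ge0// sqr_ge0.
  (* Doubling the frequency multiplies the exponent by four, so the mean of [g] is a polynomial in
     the single quantity [q = exp(-s)]. *)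
  rewrite (_ : - (u * (2 * c) ^+ 2) = 4%:R * - s); last by rewrite /s; ring.
  rewrite expRM_natl; set q := expR (- s).
  have q1 : q <= 1 by rewrite /q expR_le1 oppr_le0.
  have q0 : 0 <= q by exact: expR_ge0.
  have qs : 1 - q <= s by have := @expR_ge1Dx R (- s); rewrite -/q; lra.
  (* [3/2 - 2 q + q^4/2] has a double zero at [q = 1]. *)
  rewrite (_ : _ + _ = 2^-1 * (q ^+ 2 + 2 * q + 3) * (1 - q) ^+ 2); last by field.
  apply: ler_pM; [by nra|exact: sqr_ge0|by nra|].
  by rewrite lerXn2r ?nnegrE ?subr_ge0.
(* A lower bound of [g] on the event. It carries the same factor [c ^ 4] as the bound on the mean,
   so [c] cancels and [3 * 64 = 192] remains. *)
pose k := (a ^+ 2 * c ^+ 2 / 8) ^+ 2.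
have k0 : 0 < k by rewrite exprn_gt0// divr_gt0// mulr_gt0 ?exprn_gt0.
have mE : measurable [set w | a < `|Y w| /\ `|Y w| <= M].
  apply: (@measurableI _ _ [set w | a < `|Y w|] [set w | `|Y w| <= M]).
    exact: measurable_lt_norm.
  exact: measurable_norm_le.
have : (k%:E * P [set w | (a < `|Y w|)%R /\ (`|Y w| <= M)%R]
    <= (3 * (u * c ^+ 2) ^+ 2)%:E)%E.
  apply: (@le_trans _ _ (\int[P]_w (g w)%:E)%E); last first.
    by rewrite EFin_Rintegral// lee_fin.
  apply: markov_bound => //.
  - exact/measurable_EFinP/measurable_int/Ig.
  - by move=> w; rewrite sqr_ge0.
  - exact: ltW.
  move=> w [/ltW aY YM]; rewrite lerXn2r ?nnegrE//.
    by rewrite divr_ge0// mulr_ge0 ?exprn_ge0// ltW.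
  apply: le_trans (one_minus_cos_ge _); last first.
    by rewrite normrM gtr0_norm// mulrC ler_pdivrMr// mul1r.
  rewrite ler_pM2r// exprMn mulrC ler_pM2l ?exprn_gt0//.
  by rewrite -[leRHS]real_normK ?num_real// lerXn2r ?nnegrE// ltW.
rewrite -lee_pdivlMl//.
move=> /le_trans; apply; rewrite -EFinM lee_fin le_eqVlt; apply/orP; left.
by apply/eqP; rewrite /k; field; rewrite !gt_eqF.
Qed.

(** Continuity from below of the measure, letting the cut-off of [gaussian_tail_trunc] go to
    infinity. *)
Lemma gaussian_tail (a : R) : 0 <= u -> 0 < a ->
  (P [set w | (a < `|Y w|)%R] <= (192 * u ^+ 2 / a ^+ 4)%:E)%E.
Proof.
move=> u0 a0.
pose F (n : nat) := [set w | a < `|Y w| /\ `|Y w| <= n.+1%:R].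
have FE : \bigcup_n F n = [set w | a < `|Y w|].
  apply/seteqP; split => [w [n _] []//|w /= aY].
  exists (Num.truncn `|Y w|) => //; split => //.
  by apply/ltW/truncnS_gt.
have mF n : measurable (F n).
  apply: (@measurableI _ _ [set w | a < `|Y w|] [set w | `|Y w| <= n.+1%:R]).
    exact: measurable_lt_norm.
  exact: measurable_norm_le.
have cvgF : P (F n) @[n --> \oo] --> P (\bigcup_n F n).
  apply: nondecreasing_cvg_mu => //; first exact: bigcupT_measurable.
  move=> m n mn; apply/subsetPset => w [aY Ym]; split => //.
  by rewrite (le_trans Ym)// ler_nat ltnS.
rewrite -FE -(cvg_lim _ cvgF)//; apply: lime_le; first by apply/cvg_ex; eexists; exact: cvgF.
by apply: nearW => n; exact: gaussian_tail_trunc.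
Qed.

End gaussian_estimates.

(** * Dyadic chaining *)

(** The successor of the integer part makes the approximation strictly larger than [x], as limits
    from the right require. For fixed [j] it takes countably many values, which later turns a random
    time into deterministic ones. *)
Definition dyadic_above (R : realType) (x : R) (j : nat) : R :=
  (Num.truncn (x * 2 ^+ j)).+1%:R / 2 ^+ j.

Lemma dyadic_above_itv (R : realType) (x : R) (j : nat) : 0 <= x ->
  x < dyadic_above x j <= x + (2^-1) ^+ j.
Proof.
move=> x0; have p0 : 0 < 2 ^+ j :> R by rewrite exprn_gt0.
rewrite /dyadic_above ltr_pdivlMr// ler_pdivrMr// mulrDl exprVn mulVf ?gt_eqF//.
by have /andP[] := truncn_itv (mulr_ge0 x0 (ltW p0)); rewrite -natr1 => ? ?; lra.
Qed.

Lemma cvg_dyadic_above (R : realType) (V : topologicalType) (y : R -> V) (r x : R) :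
  0 < r -> 0 <= x -> y s @[s --> (r * x)^'+] --> y (r * x) ->
  y (r * dyadic_above x j) @[j --> \oo] --> y (r * x).
Proof.
move=> r0 x0 yx A /yx /nbhs_ballP[e /= e0 eA].
have er0 : 0 < e / r by rewrite divr_gt0.
have h2 : (2^-1 : R) ^+ j @[j --> \oo] --> (0 : R).
  by apply: cvg_expr; rewrite ger0_norm ?invr_ge0// invf_lt1// ltr1n.
move/cvgrPdist_lt : h2 => /(_ _ er0) h2.
change (\forall j \near \oo, A (y (r * dyadic_above x j))).
near=> j; have /andP[xj jx] := @dyadic_above_itv _ x j x0.
apply: eA; last by rewrite ltr_pM2l.
rewrite /ball/= distrC -mulrBr normrM (gtr0_norm r0) mulrC -ltr_pdivlMr//.
rewrite gtr0_norm ?subr_gt0//.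
have : `|0 - (2^-1 : R) ^+ j| < e / r by near: j.
rewrite sub0r normrN ger0_norm ?exprn_ge0 ?invr_ge0// => hj.
by apply: le_lt_trans hj; rewrite lerBlDl.
Unshelve. all: by end_near. Qed.

(* An odd dyadic point is reached from an even one, of the coarser level, by one
   step of its own level. *)
Lemma dyadic_chaining (R : realType) (y : R -> R) (r M th : R) :
  0 < r -> 0 <= M -> 0 < th < 1 -> y 0 = 0 ->
  (forall u : R, 0 <= u -> y s @[s --> u^'+] --> y u) ->
  (forall j i, (i < 2 ^ j)%N ->
     `|y (r * (i.+1%:R / 2 ^+ j)) - y (r * (i%:R / 2 ^+ j))| <= M * th ^+ j) ->
  forall u : R, 0 <= u <= r -> `|y u| <= M / (1 - th).
Proof.
move=> r0 M0 th01 y0 yc hy.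
(* Induction on the level: each level contributes at most one increment, bounded by its own term of
   the geometric series. *)
have dyadic j : forall i, (i <= 2 ^ j)%N ->
    `|y (r * (i%:R / 2 ^+ j))| <= M * \sum_(0 <= l < j.+1) th ^+ l.
  elim: j => [|j IH] i.
    rewrite expn0 big_nat1 expr0 mulr1.
    case: i => [_|[_|//]]; first by rewrite mul0r mulr0 y0 normr0.
    by have := hy 0%N 0%N isT; rewrite mul0r mulr0 y0 subr0 !expr0 mulr1.
  have half h : (h.*2)%:R / 2 ^+ j.+1 = h%:R / 2 ^+ j :> R.
    by rewrite exprS -muln2 natrM; field; rewrite expf_neq0.
  have th0 : 0 <= M * th ^+ j.+1.
    by case/andP: th01 => /ltW ? _; rewrite mulr_ge0// exprn_ge0.
  rewrite -(odd_double_half i) big_nat_recr//= mulrDr.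
  case: (odd i) => /= hi; last first.
    rewrite add0n half -[leLHS]addr0 lerD// IH//.
    by move: hi; rewrite add0n expnS mul2n leq_double.
  have hs : ((i./2).*2 < 2 ^ j.+1)%N by move: hi; rewrite add1n.
  have hi2 : (i./2 < 2 ^ j)%N by move: hs; rewrite expnS mul2n ltn_double.
  have := hy j.+1 _ hs; rewrite half add1n.
  have := IH _ (ltnW hi2).
  set a := y _; set b := y _ => ha hb.
  have -> : b = a + (b - a) by rewrite addrC subrK.
  by rewrite (le_trans (ler_normD _ _))// lerD.
have S i j : (i <= 2 ^ j)%N -> `|y (r * (i%:R / 2 ^+ j))| <= M / (1 - th).
  move=> ij; apply: le_trans (dyadic _ _ ij) _.
  by rewrite ler_wpM2l//; exact: sum_geometric_le.
(* The endpoint [r] is itself dyadic. For [u < r] the points [dyadic_above (u / r) j] stay at most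
   [1] and approach [u / r] from the right, so the bound passes to the limit. *)
move=> u /andP[u0]; rewrite le_eqVlt => /predU1P[->|ur].
  by have := S 1%N 0%N isT; rewrite expr0 divr1 mulr1.
have uE : r * (u / r) = u by rewrite mulrC divfK ?gt_eqF.
have ur0 : 0 <= u / r by rewrite divr_ge0// ltW.
have := @cvg_dyadic_above _ _ y r (u / r) r0 ur0; rewrite uE => /(_ (yc _ u0)) hc.
have {}hc : `|y (r * dyadic_above (u / r) j)| @[j --> \oo] --> `|y u|.
  exact: cvg_norm hc.
rewrite -(cvg_lim _ hc)//; apply: limr_le; first by apply/cvg_ex; eexists; exact: hc.
apply: nearW => j; apply: S.
have p0 : 0 < 2 ^+ j :> R by rewrite exprn_gt0.
rewrite -(@ltr_nat R) natrX.
have /andP[h _] := truncn_itv (mulr_ge0 ur0 (ltW p0)).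
by apply: le_lt_trans h _; rewrite -ltr_pdivlMr// divff ?gt_eqF// ltr_pdivrMr// mul1r.
Qed.

(** * Almost sure modulus at zero from a fourth-order tail bound on increments *)

Section modulus_at_zero.
Context {R : realType} {d : measure_display} {T : measurableType d}.
Variables (P : probability T R) (Z : R -> T -> R) (A : R).
Hypothesis mZ : forall t : R, 0 <= t -> measurable_fun [set: T] (Z t).
Hypothesis A0 : 0 <= A.
Hypothesis Ztail : forall s t a : R, 0 <= s -> 0 <= t -> 0 < a ->
  (P [set w | (a < `|Z (s + t) w - Z s w|)%R] <= (A * t ^+ 2 / a ^+ 4)%:E)%E.
Hypothesis Z0 : {ae P, forall w, Z 0 w = 0}.
Hypothesis Zc : {ae P, forall w, forall t : R, 0 <= t -> Z s w @[s --> t^'+] --> Z t w}.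

Let jump (r M : R) (j i : nat) : set T :=
  [set w | (M < `|Z (r * (i.+1%:R / 2 ^+ j)) w - Z (r * (i%:R / 2 ^+ j)) w|)%R].

Let measurable_jump (r M : R) j i : 0 <= r -> measurable (jump r M j i).
Proof.
move=> r0.
apply: (@measurable_lt_norm _ _ _ (fun w => Z (r * (i.+1%:R / 2 ^+ j)) w
  - Z (r * (i%:R / 2 ^+ j)) w)).
by apply: measurable_funB; apply: mZ; rewrite mulr_ge0// divr_ge0// exprn_ge0.
Qed.

Let bad (r M : R) : set T :=
  \bigcup_j \big[setU/set0]_(i < 2 ^ j) jump r (M * (9 / 10) ^+ j) j i.

Let measurable_bad (r M : R) : 0 <= r -> measurable (bad r M).
Proof.
move=> r0; apply: bigcupT_measurable => j; apply: bigsetU_measurable => i _.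
exact: measurable_jump.
Qed.

Let bad_le (r M : R) : 0 <= r -> 0 < M ->
  (P (bad r M) <= (5 * A * r ^+ 2 / M ^+ 4)%:E)%E.
Proof.
(* At level [j] there are [2^j] jumps, each of probability at most [A (r / 2^j)^2 / (M (9/10)^j)^4],
   so the ratio between levels is [(1/2) / (9/10)^4 = q < 1]. The factor [5] of the statement bounds
   [1 / (1 - q)]. *)
move=> r0 M0; pose q : R := 5000 / 6561.
have q01 : 0 < q < 1 by rewrite /q; lra.
have C0 : 0 <= A * r ^+ 2 / M ^+ 4.
  by rewrite divr_ge0// ?mulr_ge0 ?exprn_ge0// ltW.
apply: (@le_trans _ _ ((A * r ^+ 2 / M ^+ 4) / (1 - q))%:E).
  apply: measure_bigcup_le_geometric => // j.
    by apply: bigsetU_measurable => i _; exact: measurable_jump.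
  apply: (@le_trans _ _ (\sum_(i < 2 ^ j) P (jump r (M * (9 / 10) ^+ j) j i))%E).
    by apply: Boole_inequality => i _; exact: measurable_jump.
  apply: (@le_trans _ _ (\sum_(i < 2 ^ j)
      (A * (r / 2 ^+ j) ^+ 2 / (M * (9 / 10) ^+ j) ^+ 4)%:E)%E).
    apply: lee_sum => i _.
    have := @Ztail (r * (i%:R / 2 ^+ j)) (r / 2 ^+ j) (M * (9 / 10) ^+ j).
    rewrite (_ : _ + r / 2 ^+ j = r * (i.+1%:R / 2 ^+ j)); last first.
      by rewrite -natr1; field; rewrite expf_neq0.
    by apply; rewrite ?mulr_gt0 ?mulr_ge0 ?invr_ge0 ?exprn_ge0 ?exprn_gt0//; lra.
  rewrite sumEFin sumr_const card_ord lee_fin -[_ *+ (2 ^ j)]mulr_natr natrX le_eqVlt.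
  apply/orP; left; apply/eqP.
  rewrite (_ : q = 2^-1 / (9 / 10) ^+ 4); last by rewrite /q; field.
  have h : (9 / 10 : R) ^+ j != 0 by rewrite expf_neq0//; lra.
  rewrite [(_ / (9 / 10) ^+ 4) ^+ j]expr_div_n exprVn -exprM mulnC exprM.
  by move: h; set x := (9 / 10) ^+ j => h; field; rewrite h !gt_eqF ?exprn_gt0.
rewrite lee_fin (_ : 5 * A * r ^+ 2 / M ^+ 4 = A * r ^+ 2 / M ^+ 4 * 5); last by ring.
by rewrite ler_wpM2l// -[leRHS]invrK lef_pV2 ?posrE /q; lra.
Qed.

(** Borel-Cantelli for the bad events at [r = exp(-m)] and [M = exp(-m k)]: there
    [r^2 / M^4 = exp(-m (2 - 4 k))], which is summable since [k < 1/2]. Outside them chaining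
    applies, and [10 = 1 / (1 - 9/10)]. *)
Lemma ae_modulus_at_zero (k : R) : k < 1 / 2 ->
  {ae P, forall w, exists K : nat, forall m : nat, (K <= m)%N ->
    forall u : R, 0 <= u <= expR (- m%:R) -> `|Z u w| <= 10 * expR (- (m%:R * k))}.
Proof.
move=> k12; pose q := expR (- (2 - 4 * k)).
have q01 : 0 < q < 1 by rewrite expR_gt0 expR_lt1; lra.
have bc : {ae P, forall w, \forall m \near \oo,
    ~ bad (expR (- m%:R)) (expR (- (m%:R * k))) w}.
  apply: (@borel_cantelli_geometric _ _ _ _ _ (5 * A) q) => //.
  - by move=> m; apply: measurable_bad; exact: expR_ge0.
  - by rewrite mulr_ge0.
  move=> m; apply: le_trans (bad_le (expR_ge0 _) (expR_gt0 _)) _.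
  rewrite -mulrA lee_fin ler_wpM2l ?mulr_ge0// le_eqVlt; apply/orP; left; apply/eqP.
  rewrite -!expRM_natl -expRN -expRD; congr expR; ring.
move: bc Z0 Zc; apply: filterS3 => w [K _ hK] z0 zc; exists K => m Km u hu.
rewrite (_ : 10 = (1 - 9 / 10)^-1) 1?mulrC; last by field.
apply: (@dyadic_chaining _ (fun s => Z s w) (expR (- m%:R))) => //.
  by lra.
move=> j i ij; rewrite leNgt; apply/negP => hj.
apply: (hK m) => //; exists j => //.
by rewrite -bigcup_mkord; exists i.
Qed.

End modulus_at_zero.

(** * Growth of the Laplace exponent *)

Lemma measurable_EFin_real (R : realType) (D : set R) (g : R -> R) :
  measurable_fun D g -> measurable_fun D (fun t => (g t)%:E).
Proof. by move=> mg; exact: (measurable_EFinP D g).2. Qed.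

Lemma integral_cst_itv (R : realType) (sa sb : bool) (a b c : R) : a < b ->
  (\int[@lebesgue_measure R]_(t in [set` Interval (BSide sa a) (BSide sb b)]) c%:E
    = (c * (b - a))%:E)%E.
Proof.
move=> ab; rewrite integral_cst//= EFinM; congr (_ * _)%E.
by etransitivity; [exact: lebesgue_measure_itv|rewrite /= lte_fin ab].
Qed.

(** Cut the interval at the points [exp(-k)]. As [s <= 1], the integrand on the piece number [k] is
    at most [exp((k + 1)(1 - s))], and the piece has length at most [exp(-k)]; the products form a
    geometric series of ratio [exp(-s)]. *)
Lemma integral_powR_near0_lty (R : realType) (s : R) : 0 < s -> s <= 1 ->
  (\int[@lebesgue_measure R]_(t in `]0%R, 1%R]) (t `^ (s - 1))%:E < +oo)%E.
Proof.
move=> s0 s1; pose F (k : nat) : set R := `]expR (- k.+1%:R), expR (- k%:R)]%classic.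
have FE : (`]0%R, 1%R]%classic : set R) = \bigcup_k F k.
  apply/seteqP; split => t /=.
    rewrite in_itv/= => /expR_bracket[k /andP[k1 k2]].
    by exists k => //=; rewrite /F/= in_itv/= k1.
  move=> [k _]; rewrite /F/= !in_itv/= => /andP[k1 k2].
  by rewrite (lt_trans _ k1) ?expR_gt0//= (le_trans k2)// expR_le1.
have mpow (D : set R) : measurable_fun D (fun t : R => (t `^ (s - 1))%:E).
  by apply: measurable_EFin_real; apply: measurable_funTS; exact: measurable_powR.
rewrite FE ge0_integral_bigcup//; last 4 first.
- by move=> k; exact: measurable_itv.
- exact: mpow.
- by move=> t _; rewrite lee_fin powR_ge0.
- apply/trivIsetP => i j _ _; wlog ij : i j / (i < j)%N.
    move=> h; rewrite neq_ltn => /orP[ij|ji]; last rewrite setIC.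
      by apply: (h _ _ ij); rewrite neq_ltn ij.
    by apply: (h _ _ ji); rewrite neq_ltn ji.
  move=> _; apply/seteqP; split => t //; rewrite /F /= !in_itv/=.
  move=> [/andP[it _] /andP[_ tj]].
  have := lt_le_trans it tj; rewrite ltr_expR ltrN2 ltr_nat ltnS.
  by rewrite leqNgt ij.
pose q := expR (- s).
have q01 : 0 < q < 1 by rewrite expR_gt0 expR_lt1; lra.
apply: (@le_lt_trans _ _ (\sum_(k <oo) (expR (1 - s) * q ^+ k)%:E)%E); last first.
  by apply: le_lt_trans (nneseries_geometric_le _ q01) _; rewrite ?ltry// expR_ge0.
apply: lee_nneseries.
  by move=> k _ _; apply: integral_ge0 => t _; rewrite lee_fin powR_ge0.
move=> k _; apply: (@le_trans _ _
    (\int[@lebesgue_measure R]_(t in F k) (expR (k.+1%:R * (1 - s)))%:E)%E).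
  apply: ge0_le_integral => //.
  - exact: measurable_itv.
  - by move=> t _; rewrite lee_fin powR_ge0.
  - exact: mpow.
  move=> t; rewrite /F/= in_itv/= => /andP[kt _].
  have t0 : 0 < t by rewrite (lt_trans _ kt)// expR_gt0.
  rewrite lee_fin /powR gt_eqF// ler_expR.
  have lt : - k.+1%:R < ln t by rewrite -ltr_expR lnK.
  by rewrite -subr_ge0 (_ : _ - _ = (1 - s) * (k.+1%:R + ln t)); [nra|ring].
rewrite /F integral_cst_itv ?ltr_expR ?ltrN2 ?ltr_nat// lee_fin.
apply: (@le_trans _ _ (expR (k.+1%:R * (1 - s)) * expR (- k%:R))).
  by rewrite ler_wpM2l ?expR_ge0// lerBlDr lerDl expR_ge0.
rewrite /q -expRM_natl -!expRD ler_expR -natr1.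
by rewrite le_eqVlt; apply/orP; left; apply/eqP; ring.
Qed.

Lemma powR_gt0D (R : realType) (x r s : R) : 0 < x ->
  x `^ (r + s) = x `^ r * x `^ s.
Proof. by move=> x0; rewrite powRD// [x == 0]gt_eqF// implybT. Qed.

(** The left side is at most both [1] and [x], and [x ^ b] dominates the smaller of these. *)
Lemma one_minus_expR_le_powR (R : realType) (x b : R) : 0 < x -> 0 < b <= 1 ->
  1 - expR (- x) <= x `^ b.
Proof.
move=> x0 /andP[b0 b1]; have [x1|x1] := leP 1 x.
  apply: (@le_trans _ _ 1); first by rewrite lerBlDr lerDl expR_ge0.
  by rewrite -[leLHS](powRr0 x) ler_powR// ltW.
apply: (@le_trans _ _ x); first by have := @expR_ge1Dx R (- x); lra.
by apply: ger1_powR => //; rewrite x0 ltW.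
Qed.

Lemma ae_lebesgue_imply (R : realType) (Q1 Q2 : R -> Prop) :
  (forall t, Q1 t -> Q2 t) -> {ae @lebesgue_measure R, forall t, Q1 t} ->
  {ae @lebesgue_measure R, forall t, Q2 t}.
Proof.
move=> Q12 [N [mN N0 QN]]; exists N; split => //.
by apply: subset_trans QN; apply: subsetC => t; exact: Q12.
Qed.

(** * Bounds on the Laplace exponent at infinity from the density near zero *)

Section laplace_exponent.
Context {R : realType}.
Variables (f m : R -> R) (alpha : R) (p : nat -> R).
Hypothesis fH : hypothesis_H f m alpha p.
Local Notation mu := (@lebesgue_measure R).
Local Notation Ioo := (`]0%R, +oo[%classic : set R).

Let measurable_density : measurable_fun Ioo m.
Proof. by have [[]] := H_density fH. Qed.

Let measurable_powRI (e : R) (D : set R) : measurable_fun D (fun t : R => t `^ e).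
Proof. by apply: measurable_funTS; exact: measurable_powR. Qed.

(** Otherwise the integrand of the negative mass condition would be nonnegative almost everywhere,
    and its integral could not be negative. *)
Lemma leading_coefficient_gt0 : 0 < p 0%N.
Proof.
rewrite ltNge; apply/negP => p0.
have [_ m0 _ _] := H_density fH.
have mI : measurable Ioo by exact: measurable_itv.
have mdiff : measurable_fun Ioo (fun t => m t - p 0%N * t `^ (- 1 - alpha)).
  by apply: measurable_funB => //; exact: measurable_funM.
have := H_negative_mass fH; apply/negP; rewrite -leNgt.
rewrite (@ae_eq_integral _ _ _ mu Ioo
  (fun t => `|(m t - p 0%N * t `^ (- 1 - alpha))%:E|)%E)//.
- by apply: integral_ge0 => t _; exact: abse_ge0.
- exact: measurable_EFin_real.
- by apply: measurable_EFin_real; exact: measurableT_comp.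
- apply: ae_lebesgue_imply m0 => t m0; rewrite /= in_itv/= andbT => t0.
  rewrite ger0_norm//; rewrite subr_ge0 (le_trans _ (m0 t0))//.
  by rewrite mulr_le0_ge0// powR_ge0.
Qed.

(** The order [N = 0] of the asymptotic expansion, with tolerance [p 0 / 2]. *)
Lemma density_near0 : exists2 e : R, 0 < e <= 1 & forall t, 0 < t < e ->
  p 0%N / 2 * t `^ (- 1 - alpha) <= m t <= 2 * p 0%N * t `^ (- 1 - alpha).
Proof.
have p0 := leading_coefficient_gt0; have := H_asymptotics fH 0.
move/cvgrPdist_lt => /(_ (p 0%N / 2) (divr_gt0 p0 (ltr0n _ 2))).
rewrite /at_right /within /= => /nbhs_ballP[e /= e0 he].
exists (Num.min e 1); first by rewrite lt_min e0 ltr01/= ge_min lexx orbT.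
move=> t /andP[t0]; rewrite lt_min => /andP[te _].
have := he t; rewrite /ball/= sub0r normrN gtr0_norm// => /(_ te t0).
rewrite big_ord1 subr0 !sub0r normrN.
set x := t `^ (- 1 - alpha) => h.
have x0 : 0 < x by exact: powR_gt0.
have xV : t `^ (1 + alpha) = x^-1 by rewrite /x -opprD powRN invrK.
have : `|m t - p 0%N * x| < p 0%N / 2 * x.
  move: h; rewrite xV normrM gtr0_norm ?invr_gt0// mulrC.
  by rewrite ltr_pdivrMr.
rewrite ltr_norml => /andP[h1 h2]; apply/andP; split; nra.
Qed.

(** The density [m] is nonnegative only almost everywhere. Its positive part gives the same
    integrals and makes the integrands nonnegative at every point, as the monotonicity lemmas for
    integrals ask. *)
Let dens t := Num.max (m t) 0.

Let dens_ge0 t : 0 <= dens t. Proof. by rewrite /dens le_max lexx orbT. Qed.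

Let measurable_dens : measurable_fun Ioo dens.
Proof. exact: measurable_maxr. Qed.

Let integral_dens (g : R -> R) : measurable_fun [set: R] g ->
  (\int[mu]_(t in Ioo) (g t * m t)%:E = \int[mu]_(t in Ioo) (g t * dens t)%:E)%E.
Proof.
move=> mg; have [_ m0 _ _] := H_density fH.
have mI : measurable Ioo by exact: measurable_itv.
apply: ae_eq_integral => //.
- by apply: measurable_EFin_real; apply: measurable_funM => //; exact: measurable_funTS.
- by apply: measurable_EFin_real; apply: measurable_funM => //; exact: measurable_funTS.
apply: ae_lebesgue_imply m0 => t m0; rewrite /= in_itv/= andbT => /m0 mt.
by rewrite /dens max_l.
Qed.

Let measurable_1_expR l : measurable_fun [set: R] (fun t => 1 - expR (- (l * t))).
Proof.
apply: measurable_funB => //; apply: measurableT_comp => //.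
by apply: measurableT_comp => //; exact: measurable_funM.
Qed.

Let exponentE l : 0 <= l -> (f l)%:E =
  (\int[mu]_(t in Ioo) ((1 - expR (- (l * t))) * dens t)%:E)%E.
Proof.
move=> l0; have [_ _ _ <-//] := H_density fH.
by rewrite integral_dens//; exact: measurable_1_expR.
Qed.

Let int_ge0 l t : 0 <= l -> Ioo t ->
  (0 <= ((1 - expR (- (l * t))) * dens t)%:E)%E.
Proof.
move=> l0; rewrite /= in_itv/= andbT => t0.
by rewrite lee_fin mulr_ge0// subr_ge0 expR_le1 oppr_le0 mulr_ge0// ltW.
Qed.

Let measurable_int l : measurable_fun Ioo
  (fun t => ((1 - expR (- (l * t))) * dens t)%:E).
Proof.
apply: measurable_EFin_real; apply: measurable_funM => //.
by apply: measurable_funTS; exact: measurable_1_expR.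
Qed.

(** Only the part of the integral over [[1 / (2 l), 1 / l]] is kept: there [l * t >= 1/2] and the
    density is at least [(p 0 / 2) l^(1 + alpha)], while the interval has length [1 / (2 l)]. The
    threshold [2 / e] places this interval where [density_near0] holds. *)
Lemma exponent_lower_bound : exists2 c : R, 0 < c &
  exists2 l0 : R, 0 < l0 & forall l, l0 <= l -> c * l `^ alpha <= f l.
Proof.
have p0 := leading_coefficient_gt0; have [e /andP[e0 e1] he] := density_near0.
have k0 : 0 < 1 - expR (- (1 / 2)) :> R by rewrite subr_gt0 expR_lt1; lra.
exists ((1 - expR (- (1 / 2))) * (p 0%N / 2) / 2).
  by rewrite divr_gt0// mulr_gt0// divr_gt0.
exists (2 / e); first by rewrite divr_gt0.
move=> l hl; have l0 : 0 < l by rewrite (lt_le_trans _ hl)// divr_gt0.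
have le : l^-1 < e.
  rewrite -[e]invrK ltf_pV2 ?posrE ?invr_gt0//; apply: lt_le_trans hl.
  by rewrite ltr_pMl ?invr_gt0// ltr1n.
pose A : set R := `[l^-1 / 2, l^-1]%classic.
have il0 : 0 < l^-1 by rewrite invr_gt0.
rewrite -lee_fin exponentE; last exact: ltW.
pose c := (1 - expR (- (1 / 2))) * (p 0%N / 2 * l^-1 `^ (- 1 - alpha)).
have AI : A `<=` Ioo.
  move=> t; rewrite /A/= !in_itv/= andbT => /andP[t1 _].
  by rewrite (lt_le_trans _ t1)// divr_gt0.
have mA : measurable A by exact: measurable_itv.
apply: (@le_trans _ _ (\int[mu]_(t in A) c%:E)%E).
  rewrite /A integral_cst_itv; last by rewrite ltr_pdivrMr// ltr_pMr// ltr1n.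
  rewrite lee_fin le_eqVlt.
  apply/orP; left; apply/eqP; rewrite /c powR_gt0D//.
  rewrite !powRN powRr1 ?(ltW il0)// invrK.
  rewrite (_ : l^-1 `^ alpha = (l `^ alpha)^-1); last first.
    by rewrite -[l^-1]powR_inv1 ?(ltW l0)// -powRrM mulN1r powRN.
  by field; rewrite gt_eqF ?gt_eqF ?powR_gt0.
apply: (@le_trans _ _
    (\int[mu]_(t in A) ((1 - expR (- (l * t))) * dens t)%:E)%E); last first.
  apply: ge0_subset_integral => //.
    exact: measurable_int.
  by move=> t; apply: int_ge0; exact: ltW.
apply: ge0_le_integral => //.
- by move=> t _; rewrite lee_fin !mulr_ge0 ?powR_ge0 ?divr_ge0// ltW.
- exact: measurable_funS (measurable_int l).
move=> t; rewrite /A/= in_itv/= => /andP[t1 t2].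
have t0 : 0 < t by rewrite (lt_le_trans _ t1)// divr_gt0.
have /andP[mt _] := he t (introT andP (conj t0 (le_lt_trans t2 le))).
rewrite lee_fin; apply: ler_pM.
- exact: ltW.
- by rewrite mulr_ge0 ?powR_ge0 ?divr_ge0// ltW.
- rewrite lerD2l lerN2 ler_expR lerN2.
  by rewrite -ler_pdivrMl// mulrC mul1r mulrC.
rewrite /dens le_max; apply/orP; left; apply: le_trans mt.
rewrite ler_pM2l ?divr_gt0// -opprD !powRN lef_pV2 ?posrE ?powR_gt0//.
by apply: ge0_ler_powR; rewrite ?nnegrE ?(ltW t0) ?(ltW il0)//;
  case/andP: (H_alpha fH) => ? ?; lra.
Qed.

(** The integrand is at most [l^b] times an integrable function [H] that does not depend on [l], and
    [C] is the integral of [H]. The excess of [b] over [alpha] makes [t^(b - alpha - 1)] integrable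
    at zero. *)
Lemma exponent_upper_bound (b : R) : alpha < b <= 1 ->
  exists2 C : R, 0 <= C & forall l, 1 <= l -> f l <= C * l `^ b.
Proof.
move=> /andP[ab b1]; have /andP[a0 a1] := H_alpha fH.
have p0 := leading_coefficient_gt0; have [e /andP[e0 e1] he] := density_near0.
have mI : measurable Ioo by exact: measurable_itv.
have mmin : measurable_fun [set: R] (fun t : R => Num.min t 1).
  exact: measurable_minr.
have dens_fin : (\int[mu]_(t in Ioo) (Num.min t 1 * dens t)%:E < +oo)%E.
  by have [_ _ h _] := H_density fH; rewrite -integral_dens.
pose s := b - alpha.
pose u (t : R) := ((fun t : R => (t `^ (s - 1))%:E) \_ `]0%R, 1%R]%classic) t.
pose H (t : R) : \bar R :=
  ((2 * p 0%N)%:E * u t + e^-1%:E * (Num.min t 1 * dens t)%:E)%E.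
have u0 t : (0 <= u t)%E by apply: erestrict_ge0 => x _; rewrite lee_fin powR_ge0.
have min0 t : Ioo t -> (0 <= (Num.min t 1 * dens t)%:E)%E.
  by rewrite /= in_itv/= andbT => t0; rewrite lee_fin mulr_ge0// le_min (ltW t0)/=.
have mu1 : measurable_fun Ioo u.
  apply: measurable_funTS; apply/(measurable_restrictT _ _).1 => //.
  exact: measurable_EFin_real.
have mm : measurable_fun Ioo (fun t => (Num.min t 1 * dens t)%:E).
  by apply: measurable_EFin_real; apply: measurable_funM => //; exact: measurable_funTS.
have mH : measurable_fun Ioo H.
  by apply: emeasurable_funD; apply: measurable_funeM.
have H0 t : Ioo t -> (0 <= H t)%E.
  move=> It; rewrite /H adde_ge0// mule_ge0//; last exact: min0.
    by rewrite lee_fin mulr_ge0// ltW.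
  by rewrite lee_fin invr_ge0 ltW.
have Hfin : (\int[mu]_(t in Ioo) H t < +oo)%E.
  rewrite ge0_integralD//; first last.
  - exact: measurable_funeM.
  - by move=> y Iy; apply: mule_ge0; [rewrite lee_fin invr_ge0 ltW|exact: min0].
  - exact: measurable_funeM.
  - by move=> y Iy; rewrite mule_ge0// lee_fin mulr_ge0// ltW.
  rewrite !ge0_integralZl//; first last.
  - by rewrite lee_fin mulr_ge0// ltW.
  - by rewrite lee_fin invr_ge0 ltW.
  rewrite lte_add_pinfty// lte_mul_pinfty// ?lee_fin ?invr_ge0 ?(ltW e0)//.
    by rewrite mulr_ge0// ltW.
  rewrite -integral_mkcondr.
  apply: le_lt_trans (_ : (\int[mu]_(t in `]0%R, 1%R]) (t `^ (s - 1))%:E < +oo)%E).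
    apply: ge0_subset_integral => //.
    - exact: measurableI.
    - exact: measurable_EFin_real.
    - by move=> y _; rewrite lee_fin powR_ge0.
  by apply: integral_powR_near0_lty; rewrite /s; lra.
have IH0 : (0 <= \int[mu]_(t in Ioo) H t)%E by apply: integral_ge0 => y Iy; exact: H0.
exists (fine (\int[mu]_(t in Ioo) H t)); first exact: fine_ge0.
move=> l l1; have l0 : 0 < l by rewrite (lt_le_trans _ l1).
rewrite -lee_fin EFinM fineK ?ge0_fin_numE// exponentE ?(ltW l0)//.
rewrite muleC -ge0_integralZl//; last by rewrite lee_fin powR_ge0.
apply: ge0_le_integral => //.
- by move=> t; apply: int_ge0; exact: ltW.
- exact: measurable_int.
- exact: measurable_funeM.
move=> t It; have t0 : 0 < t by move: It; rewrite /= in_itv/= andbT.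
have lb1 : 1 <= l `^ b by rewrite -[leLHS](powRr0 l) ler_powR//; lra.
(* Below [e], the factor [1 - exp(-l t)] is at most [(l t)^b] and the density is at most
   [2 p_0 t^(-1 - alpha)]. From [e] on, that factor is at most [1], and [1 <= min(t, 1) / e] because
   [e <= 1]. *)
have [te|et] := ltP t e.
  apply: (@le_trans _ _ ((l `^ b)%:E * ((2 * p 0%N)%:E * u t))%E); last first.
    rewrite lee_wpmul2l ?lee_fin ?powR_ge0// leeDl// mule_ge0 ?min0//.
    by rewrite lee_fin invr_ge0 ltW.
  have /andP[_ mt] := he t (introT andP (conj t0 te)).
  rewrite /u patchE mem_set/=; last by rewrite in_itv/= t0 (le_trans (ltW te)).
  rewrite -!EFinM lee_fin.
  have -> : l `^ b * (2 * p 0%N * t `^ (s - 1))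
      = (l * t) `^ b * (2 * p 0%N * t `^ (- 1 - alpha)).
    rewrite powRM ?(ltW l0) ?(ltW t0)//.
    rewrite (_ : s - 1 = b + (- 1 - alpha)); last by rewrite /s; ring.
    by rewrite powR_gt0D//; ring.
  apply: ler_pM => //.
  - by rewrite subr_ge0 expR_le1 oppr_le0 mulr_ge0// ltW.
  - by apply: one_minus_expR_le_powR; [exact: mulr_gt0|lra].
  - by rewrite /dens ge_max mt/= !mulr_ge0 ?powR_ge0// ltW.
apply: (@le_trans _ _ (1 * (e^-1%:E * (Num.min t 1 * dens t)%:E))%E); last first.
  apply: lee_pmul => //.
  - by rewrite mule_ge0 ?min0// lee_fin invr_ge0 ltW.
  - by rewrite leeDr// mule_ge0// lee_fin mulr_ge0// ltW.
rewrite mul1e -EFinM lee_fin mulrA ler_wpM2r//.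
apply: (@le_trans _ _ 1); first by rewrite lerBlDr lerDl expR_ge0.
by rewrite mulrC ler_pdivlMr// mul1r le_min et.
Qed.

End laplace_exponent.

(** * Tails of the subordinator and of Brownian motion *)

(** The sets with Borel preimage form a sigma-algebra, and it contains the open rays, which generate
    the measurable sets of [R]. *)
Lemma borel_preimage (R : realType) (U : topologicalType) (g : U -> R) (A : set R) :
  continuous g -> measurable A -> borel_sets (g @^-1` A).
Proof.
move=> cg; have [B0 BD BU] := @smallest_sigma_algebra _ setT (@open U).
suff : @measurable _ R `<=` [set A | borel_sets (g @^-1` A)] by apply.
rewrite (_ : @measurable _ R = <<s @RGenOInfty.G R >>); last first.
  exact: RGenOInfty.measurableE.
apply: smallest_sub.
  split => /=.
  - by rewrite preimage_set0.
  - by move=> B hB; exact: (BD _ hB).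
  - by move=> F hF; rewrite preimage_bigcup; exact: BU.
move=> _ [x ->]; apply: sub_gen_smallest.
by move/continuousP : cg; apply; exact: interval_open.
Qed.

Lemma sigma_rv_comp (R : realType) (T : Type) (U : topologicalType) (Z : T -> U)
    (g : U -> R) (A : set R) : continuous g -> measurable A ->
  sigma_rv Z ((fun w => g (Z w)) @^-1` A).
Proof.
move=> cg mA; exists (g @^-1` A); first exact: borel_preimage.
by rewrite setTI.
Qed.

Lemma measurable_fun_sigma_rv (R : realType) (d : measure_display)
    (T : measurableType d) (U : topologicalType) (Z : T -> U) (g : U -> R) :
  continuous g -> sigma_rv Z `<=` measurable ->
  measurable_fun [set: T] (fun w => g (Z w)).
Proof. by move=> cg mZ _ A mA; rewrite setTI; apply/mZ/sigma_rv_comp. Qed.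

Lemma sigma_process_comp (R : realType) (T : Type) (U : topologicalType)
    (Z : R -> T -> U) (g : U -> R) (A : set R) (t : R) :
  0 <= t -> continuous g -> measurable A ->
  sigma_process Z ((fun w => g (Z t w)) @^-1` A).
Proof.
by move=> t0 cg mA; apply: sub_gen_smallest; exists t => //; exact: sigma_rv_comp.
Qed.

(** A form of the small-ball bound that is uniform over all [u >= r] and free of the integer
    parameter: that parameter is the integer part of [x = sqrt r / b], which exceeds [x / 2] when
    [x >= 1]. For [x < 1] the bound is larger than [1]. *)
Lemma gaussian_small_ball_le (R : realType) (d : measure_display)
    (T : measurableType d) (P : probability T R) (Y : T -> R) (u r b : R) :
  measurable_fun [set: T] Y ->
  (forall c : R, \int[P]_w cos (c * Y w) = expR (- (u * c ^+ 2))) ->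
  0 < r <= u -> 0 < b ->
  (P [set w | (`|Y w| <= b)%R] <= (24 * b / Num.sqrt r)%:E)%E.
Proof.
move=> mY charY /andP[r0 ru] b0; have sr : 0 < Num.sqrt r by rewrite sqrtr_gt0.
have mE : measurable [set w | (`|Y w| <= b)%R] by exact: measurable_norm_le.
pose x := Num.sqrt r / b; have x0 : 0 < x by rewrite divr_gt0.
have -> : 24 * b / Num.sqrt r = 24 / x by rewrite /x invf_div mulrA.
have [x1|x1] := ltP x 1.
  apply: (@le_trans _ _ 1%E); first exact: probability_le1.
  by rewrite lee_fin ler_pdivlMr// mul1r; lra.
have /andP[h1 h2] := truncn_itv (ltW x0).
case: (Num.truncn x) h1 h2 => [_|N h1 h2]; first by rewrite ltNge x1.
have bN : b * N.+1%:R <= Num.sqrt u.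
  apply: (@le_trans _ _ (Num.sqrt r)); last by rewrite ler_wsqrtr.
  by rewrite mulrC -ler_pdivlMr.
apply: le_trans (gaussian_small_ball mY charY (lt_le_trans r0 ru) bN) _.
rewrite lee_fin ler_pdivlMr// mulrAC ler_pdivrMr//.
have : 1 <= N.+1%:R :> R by rewrite ler1n.
by move: h2; rewrite -natr1; lra.
Qed.

(** For bounds valid only from some index [K] on: the sequence is shifted by [K], and
    [q ^ (k + K) <= q ^ k]. *)
Lemma borel_cantelli_near (R : realType) (d : measure_display)
    (T : measurableType d) (P : {measure set T -> \bar R}) (F : nat -> set T)
    (A q : R) :
  (forall k, measurable (F k)) -> 0 <= A -> 0 < q < 1 ->
  (\forall k \near \oo, (P (F k) <= (A * q ^+ k)%:E)%E) ->
  {ae P, forall w, \forall k \near \oo, ~ F k w}.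
Proof.
move=> mF A0 q01 [K _ PF].
have := @borel_cantelli_geometric _ _ _ P (fun k => F (k + K)%N) A q.
move=> /(_ (fun k => mF _) A0 q01) bc.
have {}bc : {ae P, forall w, \forall k \near \oo, ~ F (k + K)%N w}.
  apply: bc => k; apply: le_trans (PF _ _) _; first by rewrite /= leq_addl.
  case/andP : q01 => q0 q1.
  by rewrite lee_fin ler_wpM2l// ler_wiXn2l ?leq_addr// ltW.
apply: filterS bc => w [M _ hM]; exists (M + K)%N => // k /= Mk.
have Kk : (K <= k)%N by rewrite (leq_trans _ Mk)// leq_addl.
by rewrite -(subnK Kk); apply: hM; rewrite /= leq_subRL// addnC.
Qed.

(** * Tails of the subordinator from its Laplace transform *)

Section subordinator.
Context {R : realType} {d : measure_display} {T : measurableType d}.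
Variables (P : probability T R) (f : R -> R) (X : R -> T -> R).
Hypothesis XH : is_subordinator P f X.

Lemma subordinator_measurable (t : R) : 0 <= t -> measurable_fun [set: T] (X t).
Proof.
move=> t0; apply: (@measurable_fun_sigma_rv _ _ _ _ (X t) id).
  by move=> x; exact: cvg_id.
exact: (levy_measurable (subordinator_levy XH)).
Qed.

Let mexp (t l : R) : 0 <= t ->
  measurable_fun [set: T] (fun w => expR (- (l * X t w))).
Proof.
move=> t0; apply: measurableT_comp => //; apply: measurableT_comp => //.
by apply: measurable_funM => //; exact: subordinator_measurable.
Qed.

Let laplace (t l : R) : 0 <= t -> 0 < l ->
  (\int[P]_w (expR (- (l * X t w)))%:E = (expR (- (t * f l)))%:E)%E.
Proof.
by move=> t0 l0; have := subordinator_laplace XH t0 l0; rewrite unlock.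
Qed.

Let exp_le1 (t l : R) w : 0 <= t -> 0 < l -> expR (- (l * X t w)) <= 1.
Proof.
move=> t0 l0; rewrite expR_le1 oppr_le0 mulr_ge0 ?(ltW l0)//.
exact: (subordinator_ge0 XH).
Qed.

Let expN1_le : expR (- 1) <= 1 / 2 :> R.
Proof.
rewrite expRN div1r lef_pV2 ?posrE ?expR_gt0//.
by have := @expR_ge1Dx R 1; lra.
Qed.

(** Markov's inequality for [1 - exp(-X_t / a)]: its mean [1 - exp(-t f(1/a))] is at most
    [t f(1/a)], and on the event it is at least [1 - exp(-1) >= 1/2]. *)
Lemma subordinator_upper_tail (t a : R) : 0 <= t -> 0 < a ->
  (P [set w | (a < X t w)%R] <= (2 * t * f a^-1)%:E)%E.
Proof.
move=> t0 a0; have l0 : 0 < a^-1 by rewrite invr_gt0.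
pose g w := expR (- (a^-1 * X t w)).
have ig : P.-integrable [set: T] (fun w => (g w)%:E).
  apply: (@bounded_integrable _ _ _ _ _ 1); first exact: mexp.
  by move=> w; rewrite ger0_norm ?expR_ge0// exp_le1.
have i1 : P.-integrable [set: T] (fun w => (1 : R)%:E).
  by apply: (@bounded_integrable _ _ _ _ _ 1) => // w; rewrite normr1.
have i1g : P.-integrable [set: T] (fun w => (1 - g w)%:E).
  by under eq_fun do rewrite EFinB; exact: integrableB.
have int1g : (\int[P]_w (1 - g w)%:E <= (t * f a^-1)%:E)%E.
  rewrite EFin_Rintegral// lee_fin RintegralB// Rintegral_cst//.
  rewrite (_ : fine _ = 1); last by have := congr1 fine (@probability_setT _ _ _ P).
  have := laplace t0 l0; rewrite EFin_Rintegral// => -[->].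
  by have := @expR_ge1Dx R (- (t * f a^-1)); lra.
have : ((1 / 2)%:E * P [set w | (a < X t w)%R] <= (t * f a^-1)%:E)%E.
  apply: le_trans int1g; apply: markov_bound => //.
  - rewrite -[X in measurable X]setTI.
    rewrite (_ : [set w | _] = X t @^-1` `]a, +oo[%classic); last first.
      by apply/seteqP; split => w /=; rewrite in_itv/= andbT.
    exact: subordinator_measurable.
  - exact/measurable_EFinP/measurable_int/i1g.
  - by move=> w; rewrite subr_ge0 exp_le1.
  move=> w /= aX; apply: (@le_trans _ _ (1 - expR (- 1))).
    by have := expN1_le; lra.
  rewrite lerD2l lerN2 ler_expR lerN2 mulrC ler_pdivlMr// mul1r.
  exact: ltW.
rewrite -lee_pdivlMl; last by lra.
by move=> /le_trans; apply; rewrite -EFinM lee_fin div1r invrK mulrA.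
Qed.

(** Markov's inequality for [exp(-X_t / r)], which is at least [exp(-1)] on the event. *)
Lemma subordinator_lower_tail (t r : R) : 0 <= t -> 0 < r ->
  (P [set w | (X t w <= r)%R] <= (expR (1 - t * f r^-1))%:E)%E.
Proof.
move=> t0 r0; have l0 : 0 < r^-1 by rewrite invr_gt0.
have : ((expR (- 1))%:E * P [set w | (X t w <= r)%R] <=
    (expR (- (t * f r^-1)))%:E)%E.
  rewrite -laplace//; apply: markov_bound => //.
  - rewrite -[X in measurable X]setTI.
    rewrite (_ : [set w | _] = X t @^-1` `]-oo, r]%classic); last first.
      by apply/seteqP; split => w /=; rewrite in_itv.
    exact: subordinator_measurable.
  - exact: mexp.
  move=> w /= Xr; rewrite ler_expR lerN2 mulrC ler_pdivrMr// mul1r.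
  exact: Xr.
rewrite -lee_pdivlMl ?expR_gt0//.
by move=> /le_trans; apply; rewrite -EFinM lee_fin -expRN opprK -expRD.
Qed.

End subordinator.

(** * Coordinates of Brownian motion and its modulus at zero *)

Section brownian_coordinate.
Context {R : realType} {d : measure_display} {T : measurableType d} {n : nat}.
Variables (P : probability T R) (B : R -> T -> 'rV[R]_n).
Hypothesis BH : is_brownian_motion P B.

Lemma brownian_coordinate_measurable (i : 'I_n) (t : R) : 0 <= t ->
  measurable_fun [set: T] (fun w => B t w 0 i).
Proof.
move=> t0; apply: (@measurable_fun_sigma_rv _ _ _ _ (B t) (fun x => x 0 i)).
  exact: coord_continuous.
exact: (levy_measurable (brownian_levy BH)).
Qed.

Lemma brownian_coordinate_char (i : 'I_n) (t c : R) : 0 <= t ->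
  \int[P]_w cos (c * B t w 0 i) = expR (- (t * c ^+ 2)).
Proof.
move=> t0; pose xi : 'rV[R]_n := c *: delta_mx 0 i.
have dotE x : dot xi x = c * x 0 i.
  rewrite /dot (bigD1 i)//= !mxE !eqxx mulr1 big1 ?addr0// => j ji.
  by rewrite !mxE (negbTE ji) andbF mulr0 mul0r.
have := brownian_char BH xi t0.
rewrite /characteristic_function => -[+ _].
have -> : enorm xi ^+ 2 = c ^+ 2.
  by rewrite /enorm dotE !mxE !eqxx mulr1 -expr2 sqr_sqrtr// sqr_ge0.
by under eq_Rintegral do rewrite dotE.
Qed.

(** Stationarity replaces the increment by [B t], to which [gaussian_tail] applies with [u = t]. *)
Lemma brownian_coordinate_tail (i : 'I_n) (s t a : R) : 0 <= s -> 0 <= t -> 0 < a ->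
  (P [set w | (a < `|B (s + t) w 0 i - B s w 0 i|)%R]
    <= (192 * t ^+ 2 / a ^+ 4)%:E)%E.
Proof.
move=> s0 t0 a0.
pose A : set 'rV[R]_n := (fun x => x 0 i) @^-1` [set y : R | a < `|y|].
have bA : borel_sets A.
  apply: borel_preimage; first exact: coord_continuous.
  by apply: (@measurable_lt_norm _ _ R id); exact: measurable_id.
have := levy_stationary_increments (brownian_levy BH) s0 t0 bA.
rewrite (_ : [set w | A (B (s + t) w - B s w)] =
    [set w | a < `|B (s + t) w 0 i - B s w 0 i|]); last first.
  by apply/seteqP; split => w; rewrite /A /= !mxE.
move=> ->; apply: (@gaussian_tail _ _ _ P (fun w => B t w 0 i)) => //.
- exact: brownian_coordinate_measurable.
- by move=> c; exact: brownian_coordinate_char.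
Qed.

Lemma brownian_coordinate_right_continuous (i : 'I_n) : {ae P, forall w,
  forall t : R, 0 <= t -> B s w 0 i @[s --> t^'+] --> B t w 0 i}.
Proof.
apply: filterS (levy_cadlag (brownian_levy BH)) => w [rc _] t t0.
apply: (@cvg_comp _ _ _ (fun s => B s w) (fun x : 'rV[R]_n => x 0 i)).
  exact: rc.
exact: coord_continuous.
Qed.

Lemma brownian_modulus_at_zero (k : R) : k < 1 / 2 ->
  {ae P, forall w, exists K : nat, forall m : nat, (K <= m)%N ->
    forall u : R, 0 <= u <= expR (- m%:R) ->
    enorm (B u w) <= n%:R * (10 * expR (- (m%:R * k)))}.
Proof.
move=> k12.
have : {ae P, forall w, forall i : 'I_n, exists K : nat, forall m : nat,
    (K <= m)%N -> forall u : R, 0 <= u <= expR (- m%:R) ->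
    `|B u w 0 i| <= 10 * expR (- (m%:R * k))}.
  apply: filter_forall => i.
  apply: (@ae_modulus_at_zero _ _ _ P (fun t w => B t w 0 i) 192) => //.
  - by move=> t; exact: brownian_coordinate_measurable.
  - by move=> s t a; exact: brownian_coordinate_tail.
  - apply: filterS (levy_start (brownian_levy BH)) => w ->.
    by rewrite mxE.
  - exact: brownian_coordinate_right_continuous.
apply: filterS => w /choice[K hK].
exists (\max_(i < n) K i)%N => m Km u hu.
set M := 10 * _; have M0 : 0 <= M by rewrite mulr_ge0// expR_ge0.
have nM0 : 0 <= n%:R * M by rewrite mulr_ge0.
rewrite -[leRHS]ger0_norm// -sqrtr_sqr ler_wsqrtr// /dot.
apply: (@le_trans _ _ (\sum_(i < n) M ^+ 2)).
  apply: ler_sum => i _; rewrite -expr2 -real_normK ?num_real//.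
  rewrite lerXn2r ?nnegrE//; apply: (hK i m) => //.
  by rewrite (leq_trans _ Km)// (leq_bigmax i).
(* The crude bound [n <= n ^ 2] replaces the factor [sqrt n] by [n]. *)
rewrite sumr_const card_ord -[M ^+ 2 *+ n]mulr_natl [leRHS]exprMn ler_wpM2r ?sqr_ge0//.
by rewrite -natrX ler_nat; case: (n) => // k'; rewrite -[leqLHS]expn1 leq_pexp2l.
Qed.

Lemma coordinate_le_enorm (i : 'I_n) (x : 'rV[R]_n) : `|x 0 i| <= enorm x.
Proof.
rewrite -sqrtr_sqr ler_wsqrtr// /dot (bigD1 i)//= -expr2 lerDl.
by apply: sumr_ge0 => j _; rewrite -expr2 sqr_ge0.
Qed.

End brownian_coordinate.

(** * Subordinate Brownian motion *)

(** A lower limit of sets is the increasing union over [M] of intersections, each contained in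
    [E M]; continuity from below then gives the bound. *)
Lemma measure_liminf_le (R : realType) (d : measure_display) (T : measurableType d)
    (P : {measure set T -> \bar R}) (E : nat -> set T) (c : \bar R) :
  (forall j, measurable (E j)) -> (forall j, (P (E j) <= c)%E) ->
  (P (\bigcup_M \bigcap_(j >= M) E j) <= c)%E.
Proof.
move=> mE PE; pose F (M : nat) := \bigcap_(j in [set j | (M <= j)%N]) E j.
have mF M : measurable (F M) by apply: bigcap_measurable => //; exists M => /=.
have cvgF : P (F M) @[M --> \oo] --> P (\bigcup_M F M).
  apply: nondecreasing_cvg_mu => //; first exact: bigcupT_measurable.
  move=> M M' MM'; apply/subsetPset => w h j /= Mj; apply: h.
  exact: leq_trans Mj.
rewrite -(cvg_lim _ cvgF)//; apply: lime_le.
  by apply/cvg_ex; eexists; exact: cvgF.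
apply: nearW => M; apply: le_trans (PE M); apply: le_measure; rewrite ?inE//.
by apply: bigcap_inf => /=.
Qed.

Section subordinate_brownian_motion.
Context {R : realType} {d : measure_display} {T : measurableType d} {n : nat}.
Variables (P : probability T R) (f m : R -> R) (alpha : R) (p : nat -> R).
Variables (X : R -> T -> R) (B : R -> T -> 'rV[R]_n).
Hypothesis fH : hypothesis_H f m alpha p.
Hypothesis XH : is_subordinator P f X.
Hypothesis BH : is_brownian_motion P B.
Hypothesis XB : independent_processes P X B.

(** With [b] halfway between [alpha] and [g], the upper tail at level [exp(-k/g)] is at most
    [2 C exp(-k) exp(k b / g) = 2 C q^k], and [q < 1] since [b < g]. *)
Lemma subordinator_modulus (g : R) : alpha < g <= 1 ->
  {ae P, forall w, \forall k \near \oo, X (expR (- k%:R)) w <= expR (- (k%:R / g))}.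
Proof.
move=> /andP[ag g1]; have /andP[a0 a1] := H_alpha fH.
have g0 : 0 < g by exact: lt_trans ag.
pose b := (alpha + g) / 2.
have [C C0 fC] : exists2 C : R, 0 <= C & forall l, 1 <= l -> f l <= C * l `^ b.
  by apply: (exponent_upper_bound fH); rewrite /b; lra.
pose q := expR (- (1 - b / g)).
have q01 : 0 < q < 1.
  by rewrite expR_gt0 expR_lt1 oppr_lt0 subr_gt0 ltr_pdivrMr// mul1r /b; lra.
have : {ae P, forall w, \forall k \near \oo,
    ~ [set w | (expR (- (k%:R / g)) < X (expR (- k%:R)) w)%R] w}.
  apply: (@borel_cantelli_geometric _ _ _ P _ (2 * C) q) => //.
  - move=> k; rewrite -[X in measurable X]setTI.
    rewrite (_ : [set w | _] =
      X (expR (- k%:R)) @^-1` `]expR (- (k%:R / g)), +oo[%classic); last first.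
      by apply/seteqP; split => w /=; rewrite in_itv/= andbT.
    by apply: (subordinator_measurable XH) => //; exact: expR_ge0.
  - by rewrite mulr_ge0.
  move=> k; apply: le_trans (subordinator_upper_tail XH (expR_ge0 _) (expR_gt0 _)) _.
  rewrite lee_fin -expRN opprK.
  apply: (@le_trans _ _ (2 * expR (- k%:R) * (C * expR (k%:R / g) `^ b))).
    rewrite ler_wpM2l ?mulr_ge0 ?expR_ge0//; apply: fC.
    by rewrite -expR0 ler_expR divr_ge0// ltW.
  rewrite -expRM mulrACA ler_wpM2l ?mulr_ge0// -expRD /q -expRM_natl ler_expR.
  by rewrite le_eqVlt; apply/orP; left; apply/eqP; field; rewrite gt_eqF.
by apply: filterS => w; apply: filterS => k /= /negP; rewrite -leNgt.
Qed.

Lemma subordinate_upper_modulus (g k : R) : alpha < g <= 1 -> 0 < k < 1 / 2 ->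
  {ae P, forall w, exists C e : R, [/\ 0 <= C, 0 < e & forall t s : R,
    0 < t < e -> 0 <= s <= t -> enorm (B (X s w) w) <= C * t `^ (k / g)]}.
Proof.
move=> /[dup] ag1 /andP[ag g1] /andP[k0 k12]; have /andP[a0 a1] := H_alpha fH.
have g0 : 0 < g by exact: lt_trans ag.
have Xge0 w s : 0 <= s -> 0 <= X s w by exact: (subordinator_ge0 XH).
move: (subordinator_modulus ag1) (brownian_modulus_at_zero BH k12)
  (subordinator_increasing XH).
apply: filterS3 => w [K1 _ hX] [K2 hB] incX.
exists (n%:R * 10 * expR (k + k / g)), (expR (- (maxn K1 K2)%:R)).
split; [by rewrite !mulr_ge0// expR_ge0|exact: expR_gt0|].
move=> t s /andP[t0 te] /andP[s0 st].
have t1 : 0 < t <= 1.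
  by rewrite t0 (le_trans (ltW te))// expR_le1.
have [j /andP[jt tj]] := expR_bracket t1.
have Kj := expR_N_near0 te jt.
have [K1j K2j] : (K1 <= j)%N /\ (K2 <= j)%N.
  by move: Kj; rewrite geq_max => /andP.
have jg0 : 0 <= j%:R / g :> R by rewrite divr_ge0// ltW.
have jjg : j%:R <= j%:R / g by rewrite ler_pdivlMr// ler_piMr.
(* The Brownian modulus is known at the scales [exp(-i)] only, so [exp(-j/g)], which bounds [X s w],
   is rounded up to the next one. This rounding costs the factor [exp(k)] of the constant, and
   passing from [exp(-(j + 1))] to [t] costs [exp(k / g)]. *)
set i := Num.truncn (j%:R / g).
have /andP[i1 i2] := truncn_itv jg0.
have K2i : (K2 <= i)%N.
  rewrite -ltnS -(ltr_nat R); apply: le_lt_trans i2.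
  by apply: le_trans jjg; rewrite ler_nat.
have := hB i K2i (X s w) => /(_ _)/le_trans; apply.
  rewrite Xge0//=; apply: (@le_trans _ _ (X (expR (- j%:R)) w)).
    by apply: incX => //; exact: le_trans tj.
  by apply: le_trans (hX _ K1j) _; rewrite ler_expR lerN2.
rewrite -!mulrA ler_wpM2l// ler_wpM2l//.
rewrite /powR gt_eqF// -expRD ler_expR.
have lnt : - j.+1%:R < ln t by rewrite -ltr_expR lnK.
apply: (@le_trans _ _ (k + k / g + k / g * - j.+1%:R)); last first.
  by rewrite lerD2l ler_wpM2l ?(ltW lnt)// divr_ge0// ltW.
have -> : k + k / g + k / g * - j.+1%:R = - ((j%:R / g - 1) * k).
  by rewrite -natr1; field; rewrite gt_eqF.
by rewrite lerN2 ler_wpM2r ?(ltW k0)// lerBlDr natr1 ltW.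
Qed.

(** The time [X t w] is replaced by its dyadic approximation from the right, so that the event
    splits over countably many deterministic times. The condition [r < X t w] bounds the variance
    from below. *)
Let near_ball (i : 'I_n) (t r b : R) (j : nat) : set T :=
  [set w | (r < X t w)%R /\ (`|B (dyadic_above (X t w) j) w 0 i| <= b)%R].

Let slab (t r : R) (j l : nat) : set T :=
  [set w | (r < X t w)%R] `&` (fun w => Num.truncn (X t w * 2 ^+ j)) @^-1` [set l].

Let near_ballE i t r b j : near_ball i t r b j =
  \bigcup_l (slab t r j l `&` [set w | (`|B (l.+1%:R / 2 ^+ j) w 0 i| <= b)%R]).
Proof.
apply/seteqP; split => w.
  by move=> [rX Bb]; exists (Num.truncn (X t w * 2 ^+ j)).
by move=> [l _ [[/= rX Xl] Bb]]; split => //=; rewrite /dyadic_above Xl.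
Qed.

Let slabE (t r : R) j l : 0 <= t -> slab t r j l = X t @^-1`
  (`]r, +oo[%classic `&` `[l%:R / 2 ^+ j, l.+1%:R / 2 ^+ j[%classic).
Proof.
move=> t0; have p0 : 0 < 2 ^+ j :> R by rewrite exprn_gt0.
apply/seteqP; split => w; rewrite /slab /= !in_itv/= andbT.
  move=> [rX Xl]; split => //; rewrite ler_pdivrMr// ltr_pdivlMr//.
  rewrite -truncn_eq ?Xl//.
  by rewrite mulr_ge0 ?(ltW p0)//; exact: (subordinator_ge0 XH).
move=> [rX]; rewrite ler_pdivrMr// ltr_pdivlMr// -truncn_eq.
  by move=> /eqP.
by rewrite mulr_ge0 ?(ltW p0)//; exact: (subordinator_ge0 XH).
Qed.

Let sigma_slab (t r : R) j l : 0 <= t -> sigma_process X (slab t r j l).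
Proof.
move=> t0; rewrite slabE//; apply: (@sigma_process_comp _ _ _ X id) => //.
  by move=> x; exact: cvg_id.
by apply: measurableI; exact: measurable_itv.
Qed.

Let measurable_slab (t r : R) j l : 0 <= t -> measurable (slab t r j l).
Proof.
move=> t0; rewrite slabE// -[X in measurable X]setTI.
apply: (subordinator_measurable XH) => //.
by apply: measurableI; exact: measurable_itv.
Qed.

Let measurable_brownian_ball (i : 'I_n) (u b : R) : 0 <= u ->
  measurable [set w | (`|B u w 0 i| <= b)%R].
Proof.
move=> u0; apply: (@measurable_norm_le _ _ _ (fun w => B u w 0 i)).
exact: (brownian_coordinate_measurable BH).
Qed.

Let dyadic_ge0 (l j : nat) : 0 <= l.+1%:R / 2 ^+ j :> R.
Proof. by rewrite divr_ge0// exprn_ge0. Qed.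

Let measurable_near_ball i (t r b : R) j : 0 <= t -> measurable (near_ball i t r b j).
Proof.
move=> t0; rewrite near_ballE; apply: bigcupT_measurable => l.
by apply: measurableI; [exact: measurable_slab|exact: measurable_brownian_ball].
Qed.

(* On a slab the random time is replaced by a deterministic one, which makes
   independence applicable. *)
Let near_ball_le (i : 'I_n) (t r b : R) j : 0 <= t -> 0 < r -> 0 < b ->
  (P (near_ball i t r b j) <= (24 * b / Num.sqrt r)%:E)%E.
Proof.
move=> t0 r0 b0; set c := 24 * b / Num.sqrt r.
have c0 : 0 <= c by rewrite divr_ge0 ?sqrtr_ge0// mulr_ge0// ltW.
rewrite near_ballE.
pose ball l := [set w | (`|B (l.+1%:R / 2 ^+ j) w 0 i| <= b)%R].
have mball l : measurable (ball l) by exact: measurable_brownian_ball.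
have mslab l : measurable (slab t r j l) by exact: measurable_slab.
have tslab : trivIset setT (slab t r j) by exact: trivIset_preimage1_in.
have p0 : 0 < 2 ^+ j :> R by rewrite exprn_gt0.
apply: (@le_trans _ _ (\sum_(l <oo) P (slab t r j l `&` ball l))%E).
  apply: measure_sigma_subadditive => //.
    by move=> l; exact: measurableI.
  by apply: bigcupT_measurable => l; apply: measurableI; [exact: mslab|exact: mball].
apply: (@le_trans _ _ (\sum_(l <oo) (c%:E * P (slab t r j l)))%E).
  apply: lee_nneseries => // l _.
  rewrite XB; [|exact: sigma_slab|]; last first.
    apply: (@sigma_process_comp _ _ _ B (fun x : 'rV[R]_n => x 0 i)
      [set y : R | `|y| <= b]) => //.
      exact: coord_continuous.
    by apply: (@measurable_norm_le _ _ R id); exact: measurable_id.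
  (* Either the deterministic time exceeds [r] and the small-ball bound applies uniformly, or
     [X t w] would lie below [r] and the slab is empty. *)
  rewrite muleC; have [rl|lr] := ltP r (l.+1%:R / 2 ^+ j).
    apply: lee_wpmul2r => //.
    apply: (@gaussian_small_ball_le _ _ _ _ _ (l.+1%:R / 2 ^+ j)) => //.
    - exact: (brownian_coordinate_measurable BH).
    - by move=> y; exact: (brownian_coordinate_char BH).
    - by rewrite r0 ltW.
  rewrite (_ : slab t r j l = set0) ?measure0 ?mule0//.
  apply/seteqP; split => w //; rewrite slabE//= !in_itv/= andbT => -[rX /andP[_ Xl]].
  by have := lt_le_trans (lt_trans rX Xl) lr; rewrite ltxx.
rewrite nneseriesZl// -measure_semi_bigcup//; last exact: bigcupT_measurable.
rewrite -[leRHS]mule1 lee_wpmul2l//; apply: probability_le1.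
exact: bigcupT_measurable.
Qed.

(** The lower tail at level [exp(-k/g)] is at most [exp(1 - c q^(-k))], once [exp(k/g)] is in the
    range of [exponent_lower_bound]. Here [q < 1] because [g < alpha]. *)
Lemma subordinator_lower_modulus (g : R) : 0 < g < alpha ->
  {ae P, forall w, \forall k \near \oo, expR (- (k%:R / g)) < X (expR (- k%:R)) w}.
Proof.
move=> /andP[g0 ga]; have [c c0 [l0 l00 fc]] := exponent_lower_bound fH.
pose q := expR (- (alpha / g - 1)).
have q01 : 0 < q < 1.
  by rewrite expR_gt0 expR_lt1 oppr_lt0 subr_gt0 ltr_pdivlMr// mul1r.
have : {ae P, forall w, \forall k \near \oo,
    ~ [set w | (X (expR (- k%:R)) w <= expR (- (k%:R / g)))%R] w}.
  apply: (@borel_cantelli_near _ _ _ P _ (expR 1 / c) q) => //.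
  - move=> k; rewrite -[X in measurable X]setTI.
    rewrite (_ : [set w | _] =
      X (expR (- k%:R)) @^-1` `]-oo, expR (- (k%:R / g))]%classic); last first.
      by apply/seteqP; split => w /=; rewrite in_itv.
    by apply: (subordinator_measurable XH) => //; exact: expR_ge0.
  - by rewrite divr_ge0 ?expR_ge0// ltW.
  exists (Num.truncn (g * l0)).+1 => // k /= hk.
  apply: le_trans (subordinator_lower_tail XH (expR_ge0 _) (expR_gt0 _)) _.
  have l0k : l0 <= expR (k%:R / g).
    apply: (@le_trans _ _ (k%:R / g)); last first.
      by apply: le_trans (expR_ge1Dx _); rewrite lerDr.
    rewrite ler_pdivlMr// mulrC; apply: (@le_trans _ _ (Num.truncn (g * l0)).+1%:R).
      by apply/ltW/truncnS_gt.
    by rewrite ler_nat.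
  rewrite lee_fin -expRN opprK expRD -mulrA ler_wpM2l ?expR_ge0//.
  have := fc _ l0k; rewrite -expRM => hf.
  have cq : c * q ^- k <= expR (- k%:R) * f (expR (k%:R / g)).
    apply: (@le_trans _ _ (expR (- k%:R) * (c * expR (k%:R / g * alpha)))).
      rewrite mulrCA ler_wpM2l ?(ltW c0)// /q -expRM_natl -expRN -expRD ler_expR.
      by rewrite le_eqVlt; apply/orP; left; apply/eqP; field; rewrite gt_eqF.
    by rewrite ler_wpM2l ?expR_ge0.
  have q0 : 0 < q by case/andP : q01.
  have cq0 : 0 < c * q ^- k by rewrite mulr_gt0// invr_gt0 exprn_gt0.
  (* The inequality [exp(-x) <= 1 / x] turns the doubly exponential bound into a geometric one. *)
  apply: (@le_trans _ _ (expR (- (c * q ^- k)))); first by rewrite ler_expR lerN2.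
  rewrite expRN (_ : c^-1 * q ^+ k = (c * q ^- k)^-1); last first.
    by rewrite invfM invrK.
  rewrite lef_pV2 ?posrE ?expR_gt0//.
  by apply: le_trans (expR_ge1Dx _); rewrite lerDr.
by apply: filterS => w; apply: filterS => k /= /negP; rewrite -ltNge.
Qed.

(** A single coordinate suffices. With [r = exp(-k/g)] and [b = 2 exp(-k h)] the small-ball bound is
    [48 exp(-k (h - 1/(2 g)))], which is summable by the assumption on [h]. *)
Lemma subordinate_lower_modulus (i : 'I_n) (g h : R) : 0 < g < alpha ->
  1 / (2 * g) < h ->
  {ae P, forall w, \forall k \near \oo,
    expR (- (k%:R * h)) < enorm (B (X (expR (- k%:R)) w) w)}.
Proof.
move=> /[dup] ga /andP[g0 _] hg.
pose q := expR (- (h - 1 / (2 * g))).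
have q01 : 0 < q < 1 by rewrite expR_gt0 expR_lt1 oppr_lt0 subr_gt0.
(* By right continuity, if the coordinate at time [X] is at most [exp(-k h)] in modulus, then at
   nearby dyadic times it is at most [2 exp(-k h)]: the factor [2] leaves room for the limit. So
   [D k] contains the event to be excluded when [X] exceeds [exp(-k/g)], and [D k] is measurable. *)
pose D k := \bigcup_M \bigcap_(j >= M) near_ball i (expR (- k%:R))
  (expR (- (k%:R / g))) (2 * expR (- (k%:R * h))) j.
have bc : {ae P, forall w, \forall k \near \oo, ~ D k w}.
  apply: (@borel_cantelli_geometric _ _ _ P _ 48 q) => //.
    move=> k; apply: bigcupT_measurable => M.
    apply: bigcap_measurable; first by exists M => /=.
    by move=> j _; apply: measurable_near_ball; exact: expR_ge0.
  move=> k; apply: measure_liminf_le => j.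
    by apply: measurable_near_ball; exact: expR_ge0.
  apply: le_trans (near_ball_le _ _ _ _ _) _; rewrite ?expR_ge0 ?expR_gt0 ?mulr_gt0 ?expR_gt0//.
  rewrite lee_fin (_ : Num.sqrt _ = expR (- (k%:R / g) / 2)); last first.
    rewrite [in LHS](_ : - (k%:R / g) = - (k%:R / g) / 2 + - (k%:R / g) / 2).
      by rewrite expRD -expr2 sqrtr_sqr ger0_norm// expR_ge0.
    by field; rewrite gt_eqF.
  rewrite mulrA -natrM -mulrA -expRN -expRD /q -expRM_natl.
  rewrite ler_wpM2l// ler_expR le_eqVlt.
  by apply/orP; left; apply/eqP; field; rewrite gt_eqF.
move: bc (subordinator_lower_modulus ga) (brownian_coordinate_right_continuous BH i).
apply: filterS3 => w hD hX rc; near=> k.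
rewrite ltNge; apply/negP => hk.
have rX : expR (- (k%:R / g)) < X (expR (- k%:R)) w by near: k.
have : ~ D k w by near: k.
apply; move: hk rX; set x := X (expR (- k%:R)) w => hk rX.
have x0 : 0 <= x by apply: (subordinator_ge0 XH); exact: expR_ge0.
have Yx : `|B x w 0 i| <= expR (- (k%:R * h)).
  exact: le_trans (coordinate_le_enorm _ _) hk.
have Yc : B (dyadic_above x j) w 0 i @[j --> \oo] --> B x w 0 i.
  have := @cvg_dyadic_above _ _ (fun s => B s w 0 i) 1 x ltr01 x0.
  rewrite mul1r => /(_ (rc _ x0)).
  by under [X in X @ _ --> _ -> _]eq_fun do rewrite mul1r.
move/cvgrPdist_lt : Yc => /(_ _ (expR_gt0 (- (k%:R * h)))) [M _ hM].
exists M => // j /= Mj; split => //.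
have := hM j Mj; rewrite -/x; set y := B _ w 0 i; set z := B _ w 0 i => yz.
have -> : z = y - (y - z) by rewrite opprB addrC subrK.
apply: le_trans (ler_normB _ _) _; rewrite mulr_natl mulr2n lerD//.
exact: ltW.
Unshelve. all: by end_near. Qed.

End subordinate_brownian_motion.

(** * Choice of the exponents and passage to all small times *)

Theorem theorem3p4 (R : realType) (d : measure_display) (T : measurableType d)
    (P : probability T R) (n : nat)
    (f m : R -> R) (alpha : R) (p : nat -> R)
    (X : R -> T -> R) (B : R -> T -> 'rV[R]_n) :
  (0 < n)%N ->
  hypothesis_H f m alpha p ->
  is_subordinator P f X ->
  is_brownian_motion P B ->
  independent_processes P X B ->
  forall beta : R, 0 < beta -> beta != 2 * alpha ->
  {ae P, forall w,
    ((t `^ (- beta^-1))%:E *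
      ereal_sup [set (enorm (B (X s w) w))%:E | s in [set s : R | (0 <= s <= t)%R]])%E
      @[t --> (0 : R)^'+] --> (if (2 * alpha < beta)%R then 0 else +oo)%E}.
Proof.
move=> n0 fH XH BH XB beta b0 ba; have /andP[a0 a1] := H_alpha fH.
have i0 : 'I_n by exact: Ordinal n0.
have [ab|ab] := ltP (2 * alpha) beta.
  (* Here [g] lies strictly between [alpha] and [min(beta / 2, 1)], and [k] strictly between
     [g / beta] and [1/2]. Hence [k / g > 1 / beta], and the upper modulus [C t^(k/g)] beats the
     normalization. *)
  pose g := (alpha + Num.min (beta / 2) 1) / 2.
  have ming : alpha < Num.min (beta / 2) 1 by rewrite lt_min a1 andbT; lra.
  have minb : Num.min (beta / 2) 1 <= beta / 2 by rewrite ge_min lexx.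
  have min1 : Num.min (beta / 2) 1 <= 1 by rewrite ge_min lexx orbT.
  have ag1 : alpha < g <= 1 by rewrite /g; lra.
  have gb : g < beta / 2 by rewrite /g; lra.
  have g0 : 0 < g by rewrite /g; lra.
  have gb2 : g / beta < 1 / 2 by rewrite ltr_pdivrMr//; lra.
  pose k := (g / beta + 1 / 2) / 2.
  have gb0 : 0 < g / beta by exact: divr_gt0.
  have k12 : 0 < k < 1 / 2 by rewrite /k; lra.
  have kg : 0 < k / g - beta^-1.
    by rewrite subr_gt0 ltr_pdivlMr// mulrC /k; lra.
  apply: filterS (subordinate_upper_modulus fH XH BH ag1 k12).
  move=> w [C [e [C0 e0 hC]]].
  have lim0 : (C * t `^ (k / g - beta^-1))%:E @[t --> (0 : R)^'+] --> (0 : R)%:E.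
    apply: cvg_EFin; first by near=> t.
    by rewrite -[X in _ --> X](mulr0 C); apply: cvgMr; exact: powR_cvg0.
  apply: (squeeze_cvge _ (cvg_cst 0%E) lim0); near=> t.
  have t0 : 0 < t by near: t; exact: nbhs_right_gt.
  have te : t < e by near: t; exact: nbhs_right_lt.
  apply/andP; split.
    rewrite mule_ge0 ?lee_fin ?powR_ge0//.
    apply: (@le_trans _ _ (enorm (B (X 0 w) w))%:E).
      by rewrite lee_fin sqrtr_ge0.
    by apply: ereal_sup_ubound; exists 0 => //=; rewrite lexx ltW.
  apply: (@le_trans _ _ ((t `^ (- beta^-1))%:E * (C * t `^ (k / g))%:E)%E).
    apply: lee_wpmul2l; first by rewrite lee_fin powR_ge0.
    by apply: ge_ereal_sup => _ [s st <-]; rewrite lee_fin hC// t0.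
  by rewrite -EFinM lee_fin powR_gt0D// mulrCA [t `^ (- _) * _]mulrC.
have {}ab : beta < 2 * alpha by rewrite lt_neqAle ba.
(* Here [h] lies strictly between [1 / (2 alpha)] and [1 / beta], so that [1 / (2 h) < alpha] leaves
   room for [g] between these two. Then [1 / (2 g) < h], as the lower modulus requires. *)
pose h := (1 / (2 * alpha) + beta^-1) / 2.
have ib : 1 / (2 * alpha) < beta^-1.
  by rewrite div1r ltf_pV2 ?posrE//; lra.
have ia0 : 0 < 1 / (2 * alpha) by rewrite divr_gt0//; lra.
pose g := (1 / (2 * h) + alpha) / 2.
have h0 : 0 < h by rewrite /h; lra.
have ha : 1 / (2 * h) < alpha.
  rewrite ltr_pdivrMr; last by lra.
  have : 1 / (2 * alpha) < h by rewrite /h; lra.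
  by rewrite ltr_pdivrMr; lra.
have ih0 : 0 < 1 / (2 * h) by rewrite divr_gt0//; lra.
have ga : 0 < g < alpha by rewrite /g; lra.
have hg : 1 / (2 * g) < h.
  have : 1 / (2 * h) < g by rewrite /g; lra.
  rewrite ltr_pdivrMr; last by lra.
  by move=> ?; rewrite ltr_pdivrMr; lra.
have hb : 0 < beta^-1 - h by rewrite /h; lra.
apply: filterS (subordinate_lower_modulus fH XH BH XB i0 ga hg) => w [K _ hK].
apply/cvgeyPge => A.
have A0 : 0 < `|A| + 1 by have := normr_ge0 A; lra.
(* Once [t^(1/beta - h)] is below this threshold, [t^(-1/beta) exp(-h) t^h] exceeds [|A| + 1]. *)
have A1 : 0 < expR (- h) / (`|A| + 1) by rewrite divr_gt0 ?expR_gt0.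
have := powR_cvg0 hb; move/cvgrPdist_lt => /(_ _ A1) pw.
near=> t.
have t0 : 0 < t by near: t; exact: nbhs_right_gt.
have tK : t < expR (- K%:R) by near: t; apply: nbhs_right_lt; exact: expR_gt0.
have t1 : 0 < t <= 1 by rewrite t0 (le_trans (ltW tK))// expR_le1.
have [k /andP[kt tk]] := expR_bracket t1.
(* The supremum is bounded below by its value at the time [exp(-(k + 1))], the one of the two
   neighbours that lies below [t]. The shift of index costs the factor [exp(-h)]. *)
have Kk : (K <= k.+1)%N by rewrite ltnW// ltnS (expR_N_near0 tK kt).
have pt : `|0 - t `^ (beta^-1 - h)| < expR (- h) / (`|A| + 1) by near: t.
rewrite sub0r normrN (gtr0_norm (powR_gt0 _ t0)) in pt.
have := hK k.+1 Kk; set y := enorm _ => hy.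
apply: (@le_trans _ _ ((t `^ (- beta^-1))%:E * y%:E)%E); last first.
  apply: lee_wpmul2l; first by rewrite lee_fin powR_ge0.
  by apply: ereal_sup_ubound; exists (expR (- k.+1%:R)) => //=; rewrite expR_ge0 ltW.
rewrite -EFinM lee_fin.
apply: (@le_trans _ _ (t `^ (- beta^-1) * (expR (- h) * t `^ h))); last first.
  rewrite ler_wpM2l ?powR_ge0//; apply: le_trans (ltW hy).
  rewrite /powR gt_eqF// -expRD ler_expR.
  have lnt : ln t <= - k%:R by rewrite -ler_expR lnK.
  rewrite -natr1 -subr_ge0 (_ : _ - _ = h * (- k%:R - ln t)); last by ring.
  by rewrite mulr_ge0 ?(ltW h0)// subr_ge0.
rewrite mulrCA -powR_gt0D//.
rewrite (_ : - beta^-1 + h = - (beta^-1 - h)) ?powRN; last by ring.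
apply: (@le_trans _ _ (`|A| + 1)); first by rewrite (le_trans (ler_norm A))// lerDl.
move: pt; rewrite ltr_pdivlMr// => pt.
by rewrite ler_pdivlMr ?powR_gt0// mulrC ltW.
Unshelve. all: by end_near. Qed.
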